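(* Let $A=\mathbb{Z}[t]$ and let $G$ be a group generated by $\Sigma$. Let $H$ be a finitely generated subgroup of $\mathrm{E}(A,G)$ and let $u,v,w\in H$ be (not necessarily different) elements given by cyclically $G$-reduced words $u,v,w\in W(A,\Gamma)$ such that $|u|=|v|=|w|$ and such that the word $w$ is primitive. In addition, let $u$ and $v$ have cyclic centralizers in $H$. Then the HNN extension $$H'=\langle H,s\mid s^{-1}us=v\rangle$$ with stable letter $s$ embeds into $\mathrm{E}(A,G)$.
   Context: Ordered group. $A=\mathbb{Z}[t]$ is the additive group of integer polynomials, ordered by $\alpha\le\beta$ iff $\alpha=\beta$ or $\beta-\alpha$ has positive leading coefficient; $\mathbb{Z}\subseteq A$ as constants, and $1$ is the least positive element. Words. $G$ is generated by $\Sigma$, where $a\ne1$ in $G$ for all $a\in\Sigma$; $\Gamma=\Sigma\cup\Sigma^{-1}\subseteq G$, $\overline a=a^{-1}$ for $a\in\Gamma$, and $\pi:\Gamma^*\to G$ is the induced monoid homomorphism. A (closed) $A$-word of length $\alpha\ge 0$ is a map $p:[1,\alpha]\to\Gamma$, where $[1,\alpha]=\{\beta\in A: 1\le\beta\le\alpha\}$; $|p|=\alpha$. $W(A,\Gamma)$ is the monoid of $A$-words under concatenation: $(p\cdot q)(\beta)=p(\beta)$ for $1\le\beta\le|p|$ and $(p\cdot q)(\beta)=q(\beta-|p|)$ for $|p|<\beta\le|p|+|q|$. The involution is $\overline p(\beta)=\overline{p(|p|+1-\beta)}$. A word is finite if $|p|\in\mathbb{N}$; finite words are identified with elements of $\Gamma^*$.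 A factor of $x$ is a word $f$ with $x=pfq$ for some words $p,q$. A word $x$ is $G$-reduced if no non-empty finite factor of $x$ equals $1$ in $G$ under $\pi$; $x$ is cyclically $G$-reduced if $x^k$ is $G$-reduced for every $k\in\mathbb{N}$. $R(A,G)$ is the set of $G$-reduced words and $R^*(A,G)$ the submonoid of $W(A,\Gamma)$ generated by $R(A,G)$. Primitive words. A non-empty word $w\in W(A,\Gamma)$ is primitive if (first) $w$ does not appear as a factor of $ww$ other than as its prefix or as its suffix, and (second) $\overline w$ is not a factor of $ww$. The group $\mathrm{E}(A,G)$. $\mathcal{M}(A,G)$ is the quotient monoid of $W(A,\Gamma)$ by the relations $u\,\ell\,\overline{r}\,\overline{u}=1$ for all $u\in R(A,G)$ and $\ell,r\in\Gamma^*$ with $\pi(\ell)=\pi(r)$. $\mathrm{E}(A,G)$ is the image of $R^*(A,G)$ in $\mathcal{M}(A,G)$; it is a group, and the inverse of the class of $u\in R(A,G)$ is the class of $\overline u$. The centralizer of $u$ in $H$ is $\{v\in H: uv=vu\}$. *)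

(* Defs.v *)
From HB Require Import structures.
From mathcomp Require Import all_boot all_order all_algebra.
From mathcomp Require Import boolp classical_sets.
From mathcomp Require Import ring lra.

Set Implicit Arguments.
Unset Strict Implicit.
Unset Printing Implicit Defensive.

Import Order.TTheory GRing.Theory Num.Theory.

Local Open Scope classical_set_scope.
Local Open Scope group_scope.
Local Open Scope quotient_scope.

(* Z[t] ordered by the sign of the leading coefficient. The product is not
   used below; the ordered-ring structure is there for lra and friends. *)
Definition Zt : Type := {poly int}.
HB.instance Definition _ := GRing.IntegralDomain.on Zt.

Section OrderZt.
Local Open Scope ring_scope.
Implicit Types a b : {poly int}.

Definition Zt_le a b : bool := (a == b) || (0 < lead_coef (b - a)).
Definition Zt_lt a b : bool := (b != a) && Zt_le a b.
Definition Zt_norm a : {poly int} := if Zt_le 0 a then a else - a.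

Lemma Zt_le0E a : Zt_le 0 a = (0 <= lead_coef a).
Proof. by rewrite /Zt_le subr0 le_eqVlt ![0 == _]eq_sym lead_coef_eq0. Qed.

Lemma Zt_le0_add a b : Zt_le 0 a -> Zt_le 0 b -> Zt_le 0 (a + b).
Proof.
rewrite !Zt_le0E => a0 b0; case: (ltngtP (size a) (size b)) => [ab|ba|ab].
- by rewrite lead_coefDr.
- by rewrite lead_coefDl.
- have [->|an0] := eqVneq a 0; first by rewrite add0r.
  have bn0 : b != 0 by rewrite -size_poly_eq0 -ab size_poly_eq0.
  have pa : 0 < lead_coef a by rewrite lt_def lead_coef_eq0 an0.
  have pb : 0 < lead_coef b by rewrite lt_def lead_coef_eq0 bn0.
  have e : (a + b)`_(size a).-1 = lead_coef a + lead_coef b.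
    by rewrite coefD /lead_coef ab.
  have lt0 : 0 < (a + b)`_(size a).-1 by rewrite e addr_gt0.
  suff -> : lead_coef (a + b) = (a + b)`_(size a).-1 by rewrite ltW.
  rewrite lead_coefE; congr (_`_(_.-1)); apply/eqP.
  rewrite eqn_leq (leq_trans (size_polyD _ _)) ?ab ?maxnn //=.
  rewrite -(@prednK (size b)) ?lt0n ?size_poly_eq0 // ltnNge -ab.
  by apply/negP => /leq_sizeP /(_ _ (leqnn _)) h; rewrite h ltxx in lt0.
Qed.

Lemma Zt_le0_mul a b : Zt_le 0 a -> Zt_le 0 b -> Zt_le 0 (a * b).
Proof. by rewrite !Zt_le0E lead_coefM; apply: mulr_ge0. Qed.

Lemma Zt_sub_ge0 a b : Zt_le 0 (b - a) = Zt_le a b.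
Proof. by rewrite Zt_le0E /Zt_le le_eqVlt [0 == _]eq_sym lead_coef_eq0 subr_eq0 eq_sym. Qed.

Lemma Zt_le_opp a : Zt_le a 0 = (lead_coef a <= 0).
Proof. by rewrite -Zt_sub_ge0 sub0r Zt_le0E lead_coefN oppr_ge0. Qed.

Lemma Zt_le0_anti a : Zt_le 0 a -> Zt_le a 0 -> a = 0.
Proof.
rewrite Zt_le0E Zt_le_opp => h1 h2.
by apply/eqP; rewrite -lead_coef_eq0 eq_le h1 h2.
Qed.

Lemma Zt_le0_total a : Zt_le 0 a || Zt_le a 0.
Proof. by rewrite Zt_le0E Zt_le_opp le_total. Qed.

Lemma Zt_normN a : Zt_norm (- a) = Zt_norm a.
Proof.
rewrite /Zt_norm !Zt_le0E lead_coefN oppr_ge0 opprK.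
case: (ltrgtP (lead_coef a) 0) => // /eqP; rewrite lead_coef_eq0 => /eqP ->.
by rewrite oppr0.
Qed.

Lemma Zt_ge0_norm a : Zt_le 0 a -> Zt_norm a = a.
Proof. by rewrite /Zt_norm => ->. Qed.

Lemma Zt_lt_def a b : Zt_lt a b = (b != a) && Zt_le a b.
Proof. by []. Qed.

End OrderZt.

HB.instance Definition _ := Num.IntegralDomain_isLeReal.Build Zt
  Zt_le0_add Zt_le0_mul Zt_le0_anti Zt_sub_ge0 Zt_le0_total
  Zt_normN Zt_ge0_norm Zt_lt_def.

Definition segment (a : Zt) : Type := {b : Zt | (1 <= b <= a)%R}.
Arguments segment a%_R.

Section Words.
Variable X : Type.

Record word := Word {
  wlen : Zt;
  wlen_ge0 : (0 <= wlen)%R;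
  wfun :> segment wlen -> X }.

HB.instance Definition _ := gen_eqMixin word.
HB.instance Definition _ := gen_choiceMixin word.

Implicit Types p q r : word.

Lemma word_ext p q : wlen p = wlen q ->
  (forall b hp hq, p (exist _ b hp) = q (exist _ b hq)) -> p = q.
Proof.
case: p q => [m m0 f] [n n0 g] /= e; subst n => h.
have -> : m0 = n0 by apply: bool_irrelevance.
by congr Word; apply: funext => -[b hb]; apply: h.
Qed.

Lemma wfun_irr p b h h' : p (exist _ b h) = p (exist _ b h').
Proof. by congr (p (exist _ b _)); apply: bool_irrelevance. Qed.

Lemma segment0 (b : segment 0%R) : False.
Proof. by case: b => b /andP[b1 b0]; have := le_trans b1 b0; rewrite ler10. Qed.

Definition empty_word : word :=
  Word (lexx 0%R) (fun b => False_rect X (segment0 b)).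

Definition letter_word (x : X) : word := Word (@ler01 Zt) (fun=> x).

Lemma cat_len p q : (0 <= wlen p + wlen q)%R.
Proof. by rewrite addr_ge0 ?wlen_ge0. Qed.

Lemma cat_left p q (b : segment (wlen p + wlen q)) :
  (val b <= wlen p)%R -> (1 <= val b <= wlen p)%R.
Proof. by case: b => b /= /andP[-> _] ->. Qed.

(* The bound 1 <= b - |p| holds because 1 is the least positive element. *)
Lemma Zt_ge1 (a : Zt) : (0 < a)%R = (1 <= a)%R.
Proof.
apply/idP/idP => [a0|]; last exact: lt_le_trans.
have : Zt_lt 0 a by [].
rewrite /Zt_lt Zt_le0E => /andP[an0 la].
suff : Zt_le 1 a by [].
rewrite -Zt_sub_ge0 Zt_le0E.
have [s1|s1] := leqP (size (a : {poly int})) 1.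
  move: an0 la; rewrite (size1_polyC s1) -polyCB !lead_coefC polyC_eq0.
  by case: (_ `_ 0)%R => -[].
by rewrite lead_coefDl // size_polyN size_polyC.
Qed.

Lemma cat_right p q (b : segment (wlen p + wlen q)) :
  ~ (val b <= wlen p)%R -> (1 <= val b - wlen p <= wlen q)%R.
Proof.
by case: b => b /= /andP[_ hb] /negP; rewrite -ltNge -Zt_ge1 subr_gt0 lerBlDl => ->.
Qed.

Definition cat_fun p q (b : segment (wlen p + wlen q)) : X :=
  match decP (@idP (val b <= wlen p)%R) with
  | left h => p (exist _ (val b) (cat_left h))
  | right h => q (exist _ (val b - wlen p)%R (cat_right h))
  end.

Definition cat_word p q : word := Word (cat_len p q) (@cat_fun p q).

Lemma cat_wordl p q b h hp :
  cat_word p q (exist _ b h) = p (exist _ b hp).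
Proof.
rewrite /= /cat_fun; case: decP => [h'|/= []]; first exact: wfun_irr.
by case/andP: hp.
Qed.

Lemma cat_wordr p q b h hq :
  cat_word p q (exist _ b h) = q (exist _ (b - wlen p)%R hq).
Proof.
rewrite /= /cat_fun; case: decP => [/= h'|h']; last exact: wfun_irr.
by case/andP: (hq); rewrite -Zt_ge1 subr_gt0 ltNge h'.
Qed.

Lemma cat_wordP p q b (h : (1 <= b <= wlen p + wlen q)%R) :
  (1 <= b <= wlen p)%R \/ (1 <= b - wlen p <= wlen q)%R.
Proof.
case: (boolP (b <= wlen p)%R) => hb; [left|right].
  by case/andP: h => -> _.
by case/andP: h => _; rewrite -Zt_ge1 subr_gt0 ltNge hb lerBlDl.
Qed.

Lemma cat_wordA : associative cat_word.
Proof.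
move=> p q r; apply: word_ext => [|b h1 h2]; first by rewrite /= addrA.
case: (cat_wordP h1) => [hp|hqr].
  have hpq : (1 <= b <= wlen (cat_word p q))%R.
    by case/andP: hp => /= -> hb; rewrite ler_wpDr ?wlen_ge0.
  by rewrite (cat_wordl _ hp) (cat_wordl _ hpq) (cat_wordl _ hp).
rewrite (cat_wordr _ hqr); case: (cat_wordP hqr) => [hq|hr].
  have hpq : (1 <= b <= wlen (cat_word p q))%R.
    case/andP: hq => /= b1 b2; rewrite -lerBlDl b2 andbT.
    by rewrite (le_trans b1) // gerBl wlen_ge0.
  by rewrite (cat_wordl _ hq) (cat_wordl _ hpq) (cat_wordr _ hq).
have hr' : (1 <= b - wlen (cat_word p q) <= wlen r)%R.
  by rewrite /= opprD addrA.
rewrite (cat_wordr _ hr) (cat_wordr _ hr').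
by move: hr'; rewrite /= opprD addrA => hr'; apply: wfun_irr.
Qed.

Lemma cat_word0 : right_id empty_word cat_word.
Proof.
move=> p; apply: word_ext => [|b h1 h2]; first by rewrite /= addr0.
by rewrite (cat_wordl _ h2).
Qed.

Lemma cat_0word : left_id empty_word cat_word.
Proof.
move=> p; apply: word_ext => [|b h1 h2]; first by rewrite /= add0r.
have h : (1 <= b - wlen empty_word <= wlen p)%R by rewrite /= subr0.
by rewrite (cat_wordr _ h); move: h; rewrite /= subr0 => h; apply: wfun_irr.
Qed.

HB.instance Definition _ := isMonoid.Build word cat_wordA cat_0word cat_word0.

(* The embedding of the free monoid on X; its image is exactly the set of
   words of length n%:R for some n (wlen_finite, finite_word_surj). *)
Definition finite_word (l : seq X) : word := \prod_(x <- l) letter_word x.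

Lemma wlen_finite l : wlen (finite_word l) = ((size l)%:R)%R.
Proof.
elim: l => [|x l ih]; first by rewrite /finite_word big_nil.
by rewrite /finite_word big_cons /= -/(finite_word l) ih -[RHS]nat1r.
Qed.

Lemma finite_word_surj p n : wlen p = (n%:R)%R -> exists l, p = finite_word l.
Proof.
elim: n p => [|n ih] p hp.
  exists [::]; rewrite /finite_word big_nil; apply: word_ext => // b h h'.
  by case: (segment0 (exist _ b h')).
have h1 : (1 <= (1 : Zt) <= wlen p)%R by rewrite lexx hp ler1n.
have ht (b : segment n%:R) : (1 <= val b + 1 <= wlen p)%R.
  case: b => b /= /andP[b1 bn]; rewrite hp -natr1 lerD2r bn andbT.
  by rewrite (le_trans b1) // lerDl.
have [l hl] := ih (Word (ler0n Zt n) (fun b => p (exist _ (val b + 1)%R (ht b)))) erefl.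
exists (p (exist _ 1%R h1) :: l); rewrite /finite_word big_cons -/(finite_word l).
rewrite -hl; apply: (@word_ext _ (cat_word _ _)) => [|b hb hb'].
  by rewrite /= nat1r hp.
case: (cat_wordP hb') => hb''.
  rewrite (cat_wordl _ hb'') /=; have e : b = 1%R.
    by apply/eqP; rewrite eq_le andbC.
  by subst b; apply: wfun_irr.
rewrite (cat_wordr _ hb'') /=; move: (ht _) => /=.
have -> : (b - 1 + 1 = b)%R by ring.
by move=> h; apply: wfun_irr.
Qed.

Definition factor (f x : word) : Prop := exists p q, x = p * f * q.

Variable inv : X -> X.

Lemma rev_segment (a : Zt) (b : segment a) : (1 <= a + 1 - val b <= a)%R.
Proof. by case: b => b /= /andP[b1 ba]; apply/andP; split; lra. Qed.

Definition bar_word p : word :=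
  Word (wlen_ge0 p)
    (fun b => inv (p (exist _ (wlen p + 1 - val b)%R (rev_segment b)))).

Lemma bar_wordE p b h h' :
  bar_word p (exist _ b h) = inv (p (exist _ (wlen p + 1 - b)%R h')).
Proof. by rewrite /=; congr inv; apply: wfun_irr. Qed.

Lemma bar_cat_word p q :
  bar_word (cat_word p q) = cat_word (bar_word q) (bar_word p).
Proof.
apply: word_ext => [|b h1 h2]; first by rewrite /= addrC.
have h3 : (1 <= wlen p + wlen q + 1 - b <= wlen (cat_word p q))%R.
  by case/andP: h2 => /= b1 b2; apply/andP; split; lra.
rewrite (bar_wordE (p := cat_word p q) _ h3).
case: (cat_wordP h2) => [hq|hp].
  have h : (1 <= wlen p + wlen q + 1 - b - wlen p <= wlen q)%R.
    by case/andP: hq => /= b1 b2; apply/andP; split; lra.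
  have h' : (1 <= wlen q + 1 - b <= wlen q)%R.
    by case/andP: hq => /= b1 b2; apply/andP; split; lra.
  rewrite (cat_wordl _ hq) (cat_wordr _ h) (bar_wordE _ h'); congr inv.
  move: h; have -> : (wlen p + wlen q + 1 - b - wlen p = wlen q + 1 - b)%R.
    by ring.
  by move=> h; apply: wfun_irr.
have h : (1 <= wlen p + wlen q + 1 - b <= wlen p)%R.
  by case/andP: hp => /= b1 b2; apply/andP; split; lra.
have h' : (1 <= wlen p + 1 - (b - wlen q) <= wlen p)%R.
  by case/andP: hp => /= b1 b2; apply/andP; split; lra.
rewrite (cat_wordr _ hp) (cat_wordl _ h) (bar_wordE _ h'); congr inv.
move: h; have -> : (wlen p + wlen q + 1 - b = wlen p + 1 - (b - wlen q))%R.
  by ring.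
by move=> h; apply: wfun_irr.
Qed.

Lemma bar_wordM p q : bar_word (p * q) = bar_word q * bar_word p.
Proof. exact: bar_cat_word. Qed.

Lemma bar_word1 : bar_word 1 = 1.
Proof. by apply: word_ext => // b hb; case: (segment0 (exist _ b hb)). Qed.

Lemma bar_letter x : bar_word (letter_word x) = letter_word (inv x).
Proof. exact: word_ext. Qed.

Lemma bar_wordK : involutive inv -> involutive bar_word.
Proof.
move=> invK p; apply: word_ext => // b h1 h2 /=; rewrite invK.
move: (rev_segment _); rewrite /=.
have -> : (wlen p + 1 - (wlen p + 1 - b) = b)%R by ring.
by move=> h; apply: wfun_irr.
Qed.

Lemma finite_word_cons x l :
  finite_word (x :: l) = letter_word x * finite_word l.
Proof. by rewrite /finite_word big_cons. Qed.

Lemma finite_word_cat k l :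
  finite_word (k ++ l) = finite_word k * finite_word l.
Proof. exact: big_cat. Qed.

Lemma bar_finite l : bar_word (finite_word l) = finite_word (rev (map inv l)).
Proof.
elim: l => [|x l ih]; first by rewrite /finite_word big_nil bar_word1.
rewrite finite_word_cons bar_wordM ih map_cons rev_cons -cats1 finite_word_cat.
by rewrite bar_letter /finite_word big_seq1.
Qed.

End Words.

Section QuotientMonoid.
Variables (M : monoidType) (R : M -> M -> Prop).

Inductive cong : M -> M -> Prop :=
| cong_rel x y : R x y -> cong x y
| cong_refl x : cong x x
| cong_sym x y : cong x y -> cong y x
| cong_trans x y z : cong x y -> cong y z -> cong x z
| cong_mul x x' y y' : cong x x' -> cong y y' -> cong (x * y) (x' * y').

Definition congb (x y : M) : bool := `[< cong x y >].

Lemma congb_refl : reflexive congb.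
Proof. by move=> x; apply/asboolP; apply: cong_refl. Qed.
Lemma congb_sym : symmetric congb.
Proof. by move=> x y; apply/asboolP/asboolP; apply: cong_sym. Qed.
Lemma congb_trans : transitive congb.
Proof.
move=> y x z /asboolP xy /asboolP yz.
by apply/asboolP; apply: cong_trans yz.
Qed.

Canonical cong_equiv := EquivRel congb congb_refl congb_sym congb_trans.

Definition quotient_monoid : Type := {eq_quot cong_equiv}.
HB.instance Definition _ := Choice.on quotient_monoid.

Definition class_of (x : M) : quotient_monoid := \pi_({eq_quot cong_equiv}) x.

Lemma class_ofP x y : class_of x = class_of y <-> cong x y.
Proof.
split=> [/eqmodP /asboolP //|xy].
by apply/eqmodP; apply/asboolP.
Qed.

Lemma class_of_surj (a : quotient_monoid) : exists x, a = class_of x.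
Proof. by exists (repr (a : {eq_quot cong_equiv})); rewrite /class_of reprK. Qed.

Definition qmul (a b : quotient_monoid) : quotient_monoid :=
  class_of (repr (a : {eq_quot cong_equiv}) * repr (b : {eq_quot cong_equiv})).

Lemma qmulE x y : qmul (class_of x) (class_of y) = class_of (x * y).
Proof.
apply/class_ofP; apply: cong_mul; apply/class_ofP; rewrite /class_of reprK //.
Qed.

Lemma qmulA : associative qmul.
Proof.
move=> a b c; have [x ->] := class_of_surj a; have [y ->] := class_of_surj b.
by have [z ->] := class_of_surj c; rewrite !qmulE mulgA.
Qed.
Lemma qmul1 : left_id (class_of 1) qmul.
Proof. by move=> a; have [x ->] := class_of_surj a; rewrite qmulE mul1g. Qed.
Lemma q1mul : right_id (class_of 1) qmul.
Proof. by move=> a; have [x ->] := class_of_surj a; rewrite qmulE mulg1. Qed.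

HB.instance Definition _ := isMonoid.Build quotient_monoid qmulA qmul1 q1mul.

Lemma class_ofM x y : class_of (x * y) = class_of x * class_of y.
Proof. by rewrite -[RHS]/(qmul _ _) qmulE. Qed.
Lemma class_of1 : class_of 1 = 1. Proof. by []. Qed.

End QuotientMonoid.

Section Subgroups.
Variable K : groupType.

Definition generated (S : set K) : set K :=
  [set x | forall H : groupClosed K, (forall y, S y -> y \in H) -> x \in H].

Definition subgroup_type (H : groupClosed K) : Type := {x : K | x \in H}.

Definition finitely_generated (H : groupClosed K) : Prop :=
  exists s : seq K, [set` H] = generated [set` s].

Definition centralizer (u : K) : set K := [set v | u * v = v * u].

Definition cyclic_subset (C : set K) : Prop :=
  exists c, C = generated [set c].

End Subgroups.

Section SubgroupInstances.
Variables (K : groupType) (H : groupClosed K).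

HB.instance Definition _ := [isSub of subgroup_type H for @sval K _].
HB.instance Definition _ := [Choice of subgroup_type H by <:].

Lemma subgroup_closed : group_closed H.
Proof. by split; [exact: gpred1 | exact: gpredF]. Qed.

HB.instance Definition _ :=
  SubChoice_isSubGroup.Build K _ (subgroup_type H) subgroup_closed.
End SubgroupInstances.

Section EGroup.
Variables (G : groupType) (Sigma : set G).

(* The alphabet Sigma \cup Sigma^-1 as a subset of G: a generator and the
   inverse of another generator are the same letter if they are equal in G. *)
Definition letter : Type := {a : G | (a \in Sigma) || (a^-1 \in Sigma)}.

Lemma bar_letter_subproof (a : letter) :
  ((val a)^-1 \in Sigma) || ((val a)^-1^-1 \in Sigma).
Proof. by rewrite invgK orbC (valP a). Qed.

Definition letter_inv (a : letter) : letter :=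
  exist _ (val a)^-1 (bar_letter_subproof a).

Definition eval (l : seq letter) : G := \prod_(a <- l) val a.

Definition bar : word letter -> word letter := bar_word letter_inv.

Definition G_reduced (x : word letter) : Prop :=
  forall l : seq letter, l <> [::] -> factor (finite_word l) x -> eval l <> 1.

Definition cyclically_G_reduced (x : word letter) : Prop :=
  forall k : nat, G_reduced (x ^+ k).

Definition primitive (w : word letter) : Prop :=
  [/\ w <> 1,
      forall p q, p * w * q = w * w -> p = 1 \/ q = 1 &
      ~ factor (bar w) (w * w)].

Inductive M_rel : word letter -> word letter -> Prop :=
| M_rel_intro u l r : G_reduced u -> eval l = eval r ->
    M_rel (u * finite_word l * bar (finite_word r) * bar u) 1.

Definition M_monoid : Type := quotient_monoid M_rel.
HB.instance Definition _ := Monoid.on M_monoid.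

Definition M_class (x : word letter) : M_monoid := class_of M_rel x.

Definition R_star : set (word letter) :=
  [set x | exists2 s : seq (word letter),
     (forall p, p \in s -> G_reduced p) & x = \prod_(p <- s) p].

Definition E_set : set M_monoid := [set M_class x | x in R_star].

Definition E_group : Type := {x : M_monoid | x \in E_set}.
HB.instance Definition _ := [isSub of E_group for @sval M_monoid _].
HB.instance Definition _ := [Choice of E_group by <:].

Lemma E_closed : monoid_closed (mem E_set).
Proof.
split=> [|a b]; rewrite !inE.
  by exists 1 => //; exists [::] => //; rewrite big_nil.
move=> [x [s hs ->] <-] [y [s' hs' ->] <-].
exists (\prod_(p <- s ++ s') p); last by rewrite big_cat /M_class class_ofM.
by exists (s ++ s') => // p; rewrite mem_cat => /orP[/hs|/hs'].
Qed.

HB.instance Definition _ :=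
  SubChoice_isSubMonoid.Build M_monoid _ E_group E_closed.

Lemma letter_invK : involutive letter_inv.
Proof. by move=> a; apply: val_inj; rewrite /= invgK. Qed.

Lemma eval_bar l : eval (rev (map letter_inv l)) = (eval l)^-1.
Proof.
rewrite /eval; elim: l => [|x l ih]; first by rewrite !big_nil invg1.
by rewrite map_cons rev_cons -cats1 big_cat ih big_seq1 big_cons invgM.
Qed.

Lemma G_reduced_bar x : G_reduced x -> G_reduced (bar x).
Proof.
move=> hx l l0 [p [q e]] el.
apply: (hx (rev (map letter_inv l))); last by rewrite eval_bar el invg1.
  by case: l l0 {e el} => // a l _; rewrite map_cons rev_cons; case: (rev _).
have ex : bar (bar x) = x by apply: bar_wordK letter_invK _.
by exists (bar q), (bar p); rewrite -bar_finite -ex e /bar !bar_wordM mulgA.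
Qed.

Lemma M_class_barr x : G_reduced x -> M_class x * M_class (bar x) = 1.
Proof.
move=> hx; rewrite -class_ofM; apply/class_ofP; apply: cong_rel.
have := @M_rel_intro x [::] [::] hx erefl.
rewrite /bar bar_finite /= {1 2}/finite_word !big_nil.
by rewrite !mulg1.
Qed.

Lemma M_class_barl x : G_reduced x -> M_class (bar x) * M_class x = 1.
Proof.
move=> /G_reduced_bar/M_class_barr.
by rewrite /bar (bar_wordK letter_invK).
Qed.

Lemma E_inv_ex (a : E_group) : exists b : E_group, b * a = 1 /\ a * b = 1.
Proof.
suff: exists2 b, b \in E_set & b * val a = 1 /\ val a * b = 1.
  case=> b hb [h1 h2]; exists (Sub b hb).
  by split; apply: val_inj; rewrite gmulfM.
case: a => a /= /set_mem [x [s hs ->] <-]; elim: s hs => [|p s ih] hs.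
  exists 1; first by case: E_closed.
  by rewrite big_nil /M_class class_of1 mulg1.
have hp : G_reduced p by apply: hs; rewrite mem_head.
have [|b hb [h1 h2]] := ih; first by move=> q qs; apply: hs; rewrite inE qs orbT.
exists (b * M_class (bar p)).
  apply: E_closed.2 => //; apply/mem_set; exists (bar p) => //.
  exists [:: bar p]; last by rewrite big_seq1.
  by move=> q; rewrite inE => /eqP ->; apply: G_reduced_bar.
rewrite big_cons /M_class class_ofM -!/(M_class _); split.
  by rewrite -mulgA (mulgA (M_class (bar p))) M_class_barl // mul1g.
by rewrite -mulgA (mulgA (M_class (\prod_(p <- s) p))) h2 mul1g M_class_barr.
Qed.

(* Inverses are unique, so choosing one loses nothing. *)
Definition E_inv (a : E_group) : E_group := sval (cid (E_inv_ex a)).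

HB.instance Definition _ := hasInv.Build E_group E_inv.

Lemma E_mulVg : left_inverse 1 E_inv *%g.
Proof. by move=> a; rewrite /E_inv; case: cid => b []. Qed.
Lemma E_mulgV : right_inverse 1 E_inv *%g.
Proof. by move=> a; rewrite /E_inv; case: cid => b []. Qed.

HB.instance Definition _ := Monoid_isGroup.Build E_group E_mulVg E_mulgV.

Definition given_by (a : E_group) (x : word letter) : Prop :=
  val a = M_class x.

End EGroup.

Section HNN.
Variable K : groupType.

(* <K, s | s^-1 u s = v>, as the monoid presented by all elements of K, with
   the multiplication table of K, together with s and s^-1. *)
Inductive hnn_letter : Type :=
| HnnBase of K
| HnnStable
| HnnStableInv.

Definition hnn_word : Type := seq hnn_letter.
HB.instance Definition _ := gen_eqMixin hnn_word.
HB.instance Definition _ := gen_choiceMixin hnn_word.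
HB.instance Definition _ := isMonoid.Build hnn_word
  (@catA hnn_letter) (@cat0s hnn_letter) (@cats0 hnn_letter).

Variables u v : K.

Inductive hnn_rel : hnn_word -> hnn_word -> Prop :=
| hnn_one : hnn_rel [:: HnnBase 1] [::]
| hnn_mul h k : hnn_rel [:: HnnBase h; HnnBase k] [:: HnnBase (h * k)]
| hnn_stableV : hnn_rel [:: HnnStable; HnnStableInv] [::]
| hnn_Vstable : hnn_rel [:: HnnStableInv; HnnStable] [::]
| hnn_conj :
    hnn_rel [:: HnnStableInv; HnnBase u; HnnStable] [:: HnnBase v].

Definition HNN : Type := quotient_monoid hnn_rel.
HB.instance Definition _ := Monoid.on HNN.

Lemma HNN_inv_ex (a : HNN) : exists b : HNN, b * a = 1 /\ a * b = 1.
Proof.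
have [x ->] := class_of_surj a; elim: x => [|c x [b [h1 h2]]].
  by exists 1; rewrite class_of1 mulg1.
pose cl : hnn_word -> HNN := class_of hnn_rel.
have [d [d1 d2]] : exists d : HNN, d * cl [:: c] = 1 /\ cl [:: c] * d = 1.
  case: c => [h||].
  - exists (cl [:: HnnBase h^-1]); rewrite /cl -!class_ofM; split.
      apply/class_ofP; apply: cong_trans (cong_rel (hnn_mul _ _)) _.
      by rewrite mulVg; apply: cong_rel; exact: hnn_one.
    apply/class_ofP; apply: cong_trans (cong_rel (hnn_mul _ _)) _.
    by rewrite mulgV; apply: cong_rel; exact: hnn_one.
  - exists (cl [:: HnnStableInv]); rewrite /cl -!class_ofM.
    by split; apply/class_ofP; apply: cong_rel; constructor.
  - exists (cl [:: HnnStable]); rewrite /cl -!class_ofM.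
    by split; apply/class_ofP; apply: cong_rel; constructor.
exists (b * d).
have -> : class_of hnn_rel (c :: x) = cl [:: c] * cl x by rewrite /cl -class_ofM.
split; first by rewrite -mulgA (mulgA d) d1 mul1g.
by rewrite -mulgA (mulgA (cl x)) h2 mul1g.
Qed.

Definition HNN_inv (a : HNN) : HNN := sval (cid (HNN_inv_ex a)).
HB.instance Definition _ := hasInv.Build HNN HNN_inv.

Lemma HNN_mulVg : left_inverse 1 HNN_inv *%g.
Proof. by move=> a; rewrite /HNN_inv; case: cid => b []. Qed.
Lemma HNN_mulgV : right_inverse 1 HNN_inv *%g.
Proof. by move=> a; rewrite /HNN_inv; case: cid => b []. Qed.

HB.instance Definition _ := Monoid_isGroup.Build HNN HNN_mulVg HNN_mulgV.
End HNN.

Definition embeds_into (K L : groupType) : Prop :=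
  exists f : {multiplicative K -> L}, injective f.

(* Main.v *)
From HB Require Import structures.
Require Import Defs.
From mathcomp Require Import all_boot all_order all_algebra.
From mathcomp Require Import boolp classical_sets.
From mathcomp Require Import ring lra zify.

(** The stable letter is sent to the class of a word [s] whose length 'X^D
    exceeds the degree of all elements of H. Call two positions of [s]
    close if their distance is bounded by a multiple of |w|. The positions
    close to the left end carry u u u ..., those close to the right end carry
    ... v v v, and each of the other classes of close positions carries a
    bi-infinite power of w. Then u s = s v holds already for words, and [s] is
    reduced because each finite factor lies in a power of u, v or w. So there
    is a homomorphism from H' to E(A,G), and it remains to see that its kernel
    is trivial.

    The kernel is accessible through a description of the words that
    represent an element of G. They are generated by letters, products and
    the passage from a word x of value 1 to u x ubar with u reduced
    ([value]). That no other word is trivial in E(A,G) is a confluence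
    statement: inserting and deleting the two sides of a defining relation
    does not leave this class, the hard part being the deletion of u ubar
    ([value_cancel], which rests on [value_replace]).

    Now let a product of elements of H and stable letters be trivial in
    E(A,G). A derivation of its triviality contains an innermost pair of
    cancelling factors f, fbar of degree D ([value_pairing]). Since the only
    long syllables are s and sbar, and these cannot be cut into two long
    parts, f and fbar are essentially all of two consecutive stable letters,
    with some h in H between them, and b h b' = 1 for the short ends b, b'
    that f and fbar leave over ([spell_pinch]).
    - If the two stable letters have the same sign, then wbar, as a factor of
      fbar, occurs in a power of w, which primitivity forbids
      ([stable_no_inverse]).
    - If they are sbar and s, then fbar occurs in s at two places p and p', and
      h is the quotient of p and p'. Both p and p' conjugate a prefix z of
      fbar to u because s has period u, and they differ by a prefix c of fbar
      that commutes with z. Hence h centralizes u. As the centralizer of u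
      in H is cyclic, some power of c is a power of z, so the shift |c| is at
      most a multiple of |w|. The two occurrences of fbar are thus so close
      that a power of w inside fbar overlaps itself with shift |c|. By
      primitivity |c| is a multiple of |w| and c is a power of z, so h is a
      power of u ([pinch_power]). The case of s and sbar is the mirror image.
    So the product has a pinch in the sense of HNN extensions, and removing
    it shortens the product ([embedding_kernel]). *)


Set Implicit Arguments.
Unset Strict Implicit.
Unset Printing Implicit Defensive.

Import Order.TTheory GRing.Theory Num.Theory.

Local Open Scope classical_set_scope.
Local Open Scope group_scope.

(** * Words: cutting, cancelling and refining factorizations *)

Section WordCombinatorics.
Variable X : Type.
Implicit Types p q r x y z : word X.

Lemma wfun_eq p q b hp hq : p = q -> p (exist _ b hp) = q (exist _ b hq).
Proof. by move=> e; subst q; apply: wfun_irr. Qed.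

Lemma wlenM p q : wlen (p * q) = (wlen p + wlen q)%R.
Proof. by []. Qed.

Lemma wlen1 : wlen (1 : word X) = 0%R.
Proof. by []. Qed.

Lemma wlenX p n : wlen (p ^+ n) = (wlen p *+ n)%R.
Proof.
elim: n => [|n ih]; first by rewrite expg0 mulr0n.
by rewrite expgS wlenM ih mulrS.
Qed.

Lemma wlen_eq0 p : wlen p = 0%R -> p = 1.
Proof.
move=> e; apply: word_ext => // b hp hq.
by case: (segment0 (exist _ b hq)).
Qed.

Lemma wlen_le0 p : (wlen p <= 0)%R -> p = 1.
Proof. by move=> h; apply: wlen_eq0; apply/eqP; rewrite eq_le h wlen_ge0. Qed.

Lemma mulw_inj p q p' q' : p * q = p' * q' -> wlen p = wlen p' ->
  p = p' /\ q = q'.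
Proof.
move=> e lp.
have lq : wlen q = wlen q'.
  by have := congr1 (@wlen X) e; rewrite !wlenM lp => /addrI.
have ge p1 q1 : (0 <= wlen p1 :> Zt)%R /\ (0 <= wlen q1 :> Zt)%R.
  by split; exact: (@wlen_ge0 X).
split; apply: word_ext => // b h1 h2.
  have h : (1 <= b <= wlen (cat_word p q))%R.
    by case/andP: h1 => -> hb /=; rewrite ler_wpDr ?wlen_ge0.
  have h' : (1 <= b <= wlen (cat_word p' q'))%R.
    by case/andP: h2 => -> hb /=; rewrite ler_wpDr ?wlen_ge0.
  rewrite -(cat_wordl h h1) -(cat_wordl h' h2); exact: wfun_eq.
have h : (1 <= b + wlen p <= wlen (cat_word p q))%R.
  case/andP: h1 => b1 b2 /=; rewrite addrC lerD2l b2 andbT.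
  by rewrite (le_trans b1) // lerDr wlen_ge0.
have h' : (1 <= b + wlen p <= wlen (cat_word p' q'))%R.
  case/andP: h2 => b1 b2 /=; rewrite addrC lp lerD2l b2 andbT.
  by rewrite (le_trans b1) // lerDr wlen_ge0.
have k : (1 <= b + wlen p - wlen p <= wlen q)%R by rewrite addrK.
have k' : (1 <= b + wlen p - wlen p' <= wlen q')%R by rewrite lp addrK.
have := wfun_eq h h' e; rewrite (cat_wordr h k) (cat_wordr h' k').
move: k k'; rewrite -lp addrK => k k' E.
by rewrite (wfun_irr (p := q) h1 k) E; apply: wfun_irr.
Qed.

Lemma mulwI p : injective (fun q => p * q).
Proof. by move=> q q' e; have [] := mulw_inj e erefl. Qed.

Lemma wlen_conj p q r : p * q = q * r -> wlen p = wlen r.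
Proof. by move=> /(congr1 (@wlen X)); rewrite !wlenM addrC => /addrI. Qed.

Lemma cut_word p (a : Zt) : (0 <= a <= wlen p)%R ->
  exists p1 p2, p = p1 * p2 /\ wlen p1 = a.
Proof.
case/andP=> a0 ap.
have h1 (b : segment a) : (1 <= val b <= wlen p)%R.
  by case: b => b /= /andP[-> hb]; apply: le_trans ap.
have l2 : (0 <= wlen p - a)%R by rewrite subr_ge0.
have h2 (b : segment (wlen p - a)%R) : (1 <= a + val b <= wlen p)%R.
  case: b => b /= /andP[b1 hb]; rewrite addrC -lerBrDr hb andbT.
  by rewrite (le_trans b1) // lerDl.
pose p1 := Word a0 (fun b => p (exist _ (val b) (h1 b))).
pose p2 := Word l2 (fun b => p (exist _ (a + val b)%R (h2 b))).
exists p1, p2; split=> //.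
apply: (@word_ext X p (cat_word p1 p2)) => [|b hp hq].
  by rewrite /= addrC subrK.
case: (cat_wordP hq) => hb.
  by rewrite (cat_wordl _ hb) /=; apply: wfun_irr.
rewrite (cat_wordr _ hb) /=; move: (h2 _) => /=.
by rewrite addrC subrK => hb'; apply: wfun_irr.
Qed.

(** Two factorizations of the same word have a common refinement. Every
    comparison of words below reduces to this. *)
Lemma levi p q p' q' : p * q = p' * q' -> (wlen p <= wlen p')%R ->
  exists2 z, p' = p * z & q = z * q'.
Proof.
move=> e le.
have [p1 [z [e1 l1]]] : exists p1 z, p' = p1 * z /\ wlen p1 = wlen p.
  by apply: cut_word; rewrite wlen_ge0.
move: e; rewrite e1 -mulgA => e; have [e2 e3] := mulw_inj e (esym l1).
by exists z; rewrite ?e2.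
Qed.

Lemma leviP p q p' q' : p * q = p' * q' ->
  (exists2 z, p' = p * z & q = z * q') \/
  (exists2 z, p = p' * z & q' = z * q).
Proof.
move=> e; have [le|/ltW le] := leP (wlen p) (wlen p'); [left|right].
  exact: levi.
exact: levi (esym e) le.
Qed.

Lemma wlen_lt1 p : (wlen p < 1)%R -> p = 1.
Proof.
move=> h; apply: wlen_le0; rewrite leNgt; apply/negP.
by rewrite Zt_ge1 leNgt h.
Qed.

(** Words read off a total function on Z[t]. Equalities between them become
    equalities between functions, and factors become shifted windows. *)
Definition wseg (S : Zt -> X) (a L : Zt) (L0 : (0 <= L)%R) : word X :=
  Word L0 (fun b => S (a + val b)%R).

Lemma wsegM S a L L' h h' h'' :
  @wseg S a L h * @wseg S (a + L)%R L' h' = @wseg S a (L + L')%R h''.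
Proof.
apply: (@word_ext X (cat_word _ _) _) => [|b hp hq] //.
case: (cat_wordP hp) => hb.
  by rewrite (cat_wordl _ hb).
by rewrite (cat_wordr _ hb) /=; congr S; ring.
Qed.

Lemma wseg_factor S a L h x y z : @wseg S a L h = x * y * z ->
  y = @wseg S (a + wlen x)%R (wlen y) (wlen_ge0 y).
Proof.
move=> e; have lL : L = (wlen x + wlen y + wlen z)%R.
  by rewrite -[L]/(wlen (wseg S a h)) e !wlenM.
subst L.
have h1 : (0 <= wlen x + wlen y)%R := cat_len x y.
move: e; rewrite -(wsegM S a h1 (wlen_ge0 z)) => e.
have [e1 _] := mulw_inj e erefl.
move: e1; rewrite -(wsegM S a (wlen_ge0 x) (wlen_ge0 y)) => e1.
by have [_ <-] := mulw_inj e1 erefl.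
Qed.

Lemma eq_wseg S S' a a' L h : 
  (forall b : Zt, (1 <= b <= L)%R -> S (a + b)%R = S' (a' + b)%R) ->
  @wseg S a L h = @wseg S' a' L h.
Proof. by move=> e; apply: word_ext => // b hp hq /=; apply: e. Qed.

End WordCombinatorics.

(** * Degrees in Z[t] *)

Section Degrees.
Local Open Scope ring_scope.
Implicit Types a b : Zt.

(** The degree plus one: all that the coarse arguments retain of a length. *)
Definition zsize (a : Zt) : nat := size (a : {poly int}).

Lemma zleE a b : (a <= b) = (0 <= lead_coef (b - a : {poly int})).
Proof. by rewrite -[(a <= b)]/(Zt_le a b) -Zt_sub_ge0 Zt_le0E. Qed.

Lemma zge0E a : (0 <= a) = (0 <= lead_coef (a : {poly int})).
Proof. by rewrite zleE subr0. Qed.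

Lemma zgt0E a : (0 < a) = (0 < lead_coef (a : {poly int})).
Proof. by rewrite !lt_def lead_coef_eq0 zge0E. Qed.

Lemma lt_zsize a b : (zsize a < zsize b)%N -> 0 <= b -> a <= b.
Proof.
move=> ab; rewrite zleE zge0E => b0.
by rewrite lead_coefDl // size_polyN.
Qed.

Lemma zsize_le a b : 0 <= a -> a <= b -> (zsize a <= zsize b)%N.
Proof.
move=> a0 ab; rewrite leqNgt; apply/negP => ba.
have := lt_zsize ba a0 => /(conj ab) /andP; rewrite -eq_le => /eqP e.
by move: ba; rewrite e ltnn.
Qed.

Lemma zsizeD a b : 0 <= a -> 0 <= b -> zsize (a + b) = maxn (zsize a) (zsize b).
Proof.
move=> a0 b0; apply/eqP; rewrite eqn_leq size_polyD geq_max.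
by rewrite !zsize_le // ?lerDl ?lerDr.
Qed.

Lemma zsizeMn a n : (zsize (a *+ n) <= zsize a)%N.
Proof.
elim: n => [|n ih]; first by rewrite mulr0n /zsize size_poly0.
rewrite mulrS; apply: leq_trans (size_polyD _ _) _.
by rewrite geq_max leqnn.
Qed.

(** The multiples of [b] exceed everything of degree at most the degree of
    [b]; for equal degrees, compare leading coefficients. *)
Lemma zarch a b : 0 < b -> (zsize a <= zsize b)%N -> exists n : nat, a <= b *+ n.
Proof.
move=> b0; rewrite leq_eqVlt => /orP[/eqP ab|ab]; last first.
  by exists 1%N; rewrite mulr1n lt_zsize // ltW.
move: (b0); rewrite zgt0E => lb.
pose la := lead_coef (a : {poly int}); pose n := (absz la).+1.
exists n; pose k := (zsize b).-1.
have kb : (k < zsize b)%N.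
  rewrite /k prednK // lt0n size_poly_eq0; apply/eqP => e.
  by rewrite e ltxx in b0.
pose c : {poly int} := (b *+ n - a : {poly int}).
have ck : c`_k > 0.
  have ek : c`_k = lead_coef (b : {poly int}) *+ n - la.
    rewrite /c coefB coefMn /la !lead_coefE -/(zsize b) -/(zsize a) ab //.
  rewrite ek subr_gt0; apply: le_lt_trans (ler_norm _) _.
  apply: (@lt_le_trans _ _ (1 *+ n)); last first.
    by apply: ler_wMn2r; rewrite -gtz0_ge1.
  by rewrite -abszE /n -[ltRHS]/((absz la).+1%:R) pmulrn intz ltz_nat.
have sc : size c = k.+1.
  apply/eqP; rewrite eqn_leq ltnNge; apply/andP; split; last first.
    by apply/negP => /leq_sizeP /(_ _ (leqnn _)) e; rewrite e ltxx in ck.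
  rewrite /c (leq_trans (size_polyD _ _)) // geq_max size_polyN -/(zsize a) ab.
  rewrite /k prednK ?(leq_ltn_trans _ kb) // leqnn andbT.
  exact: zsizeMn.
by rewrite zleE -/c lead_coefE sc ltW.
Qed.

Lemma zsize_Xn n : zsize ('X^n : {poly int}) = n.+1.
Proof. exact: size_polyXn. Qed.

Lemma zXn_gt0 n : 0 < ('X^n : Zt).
Proof. by rewrite zgt0E lead_coefXn. Qed.

(** The coefficients of degree [n] of [a] and [b] are nonnegative integers
    with sum 1, so one of them vanishes. This is why a word of length 'X^n
    cannot be cut into two long parts. *)
Lemma zXn_split n a b : 0 <= a -> 0 <= b -> a + b = 'X^n ->
  (zsize a <= n)%N \/ (zsize b <= n)%N.
Proof.
move=> a0 b0 e.
have [|an] := leqP (zsize a) n; [by left|].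
have [|bn] := leqP (zsize b) n; [by right|].
exfalso.
have sm : maxn (zsize a) (zsize b) = n.+1 by rewrite -zsizeD // e zsize_Xn.
have sa : zsize a = n.+1.
  by apply/eqP; rewrite eqn_leq an -sm leq_maxl.
have sb : zsize b = n.+1.
  by apply/eqP; rewrite eqn_leq bn -sm leq_maxr.
have e' : (a : {poly int})`_n + (b : {poly int})`_n = 1.
  by rewrite -coefD (_ : (a + b : {poly int}) = 'X^n) // coefXn eqxx.
have pa : 0 < (a : {poly int})`_n.
  move: a0; rewrite zge0E lead_coefE -/(zsize a) sa /= lt_def => ->.
  by rewrite andbT -[n]/(n.+1.-1) -sa -lead_coefE lead_coef_eq0 -size_poly_eq0
     -/(zsize a) sa.
have pb : 0 < (b : {poly int})`_n.
  move: b0; rewrite zge0E lead_coefE -/(zsize b) sb /= lt_def => ->.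
  by rewrite andbT -[n]/(n.+1.-1) -sb -lead_coefE lead_coef_eq0 -size_poly_eq0
     -/(zsize b) sb.
lia.
Qed.

End Degrees.

Section Letters.
Variable X : Type.
Implicit Types p q : word X.

Lemma mulw_injr p q p' q' : p * q = p' * q' -> wlen q = wlen q' ->
  p = p' /\ q = q'.
Proof.
move=> e lq; apply: mulw_inj (e) _.
by have := congr1 (@wlen X) e; rewrite !wlenM lq => /addIr.
Qed.

Lemma mulw_eq1 p q : p * q = 1 -> p = 1 /\ q = 1.
Proof.
move=> /(congr1 (@wlen X)); rewrite wlenM wlen1 => e.
have p0 := wlen_ge0 p; have q0 := wlen_ge0 q.
by split; apply: wlen_le0; lra.
Qed.

Lemma wlen_pos p : p <> 1 -> (1 <= wlen p)%R.
Proof. by move=> p1; rewrite leNgt; apply/negP => /wlen_lt1. Qed.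

Lemma finite_word1 : finite_word [::] = 1 :> word X.
Proof. by rewrite /finite_word big_nil. Qed.

Lemma finite_word_letter (a : X) : finite_word [:: a] = letter_word a.
Proof. by rewrite /finite_word big_seq1. Qed.

Lemma wlen_one p : wlen p = 1%R -> exists a, p = letter_word a.
Proof.
move=> lp; have [l pl] := @finite_word_surj _ p 1 lp.
move: lp; rewrite pl wlen_finite.
case: l {pl} => [|a [|b l]] /=.
- by move=> /eqP; rewrite eq_sym oner_eq0.
- by move=> _; exists a; rewrite finite_word_letter.
by move=> /eqP; rewrite pnatr_eq1.
Qed.

Lemma letter_word_inj : injective (@letter_word X).
Proof.
move=> a b e; have h : (1 <= (1 : Zt) <= wlen (letter_word a))%R by rewrite lexx /=.
have h' : (1 <= (1 : Zt) <= wlen (letter_word b))%R by rewrite lexx /=.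
exact: (wfun_eq h h' e).
Qed.

Lemma letter_word_neq1 (a : X) : letter_word a = 1 -> False.
Proof. by move/(congr1 (@wlen X)) => /eqP; rewrite /= oner_eq0. Qed.

Lemma first_letter p : p <> 1 -> exists a p', p = letter_word a * p'.
Proof.
move=> /wlen_pos p1.
have [|b [p' [e /wlen_one [a ea]]]] := @cut_word _ p 1%R; first by rewrite ler01.
by exists a, p'; rewrite e ea.
Qed.

Lemma last_letter p : p <> 1 -> exists a p', p = p' * letter_word a.
Proof.
move=> /wlen_pos p1.
have [|p' [b [e lp']]] := @cut_word _ p (wlen p - 1)%R.
  by rewrite subr_ge0 p1 gerBl ler01.
have [|a ea] := @wlen_one b; last by exists a, p'; rewrite e ea.
by move: (congr1 (@wlen X) e); rewrite wlenM => h; lra.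
Qed.

Lemma letter_word_cut (a : X) p q : letter_word a = p * q ->
  (p = 1 /\ q = letter_word a) \/ (p = letter_word a /\ q = 1).
Proof.
move=> e; have [p1|/wlen_pos p1] := pselect (p = 1).
  by left; move: e; rewrite p1 mul1g.
right; have q1 : q = 1.
  apply: wlen_le0; have := congr1 (@wlen X) e; rewrite wlenM /= => h; lra.
by move: e; rewrite q1 mulg1.
Qed.

Lemma finite_word_inj : injective (@finite_word X).
Proof.
elim=> [|a l ih] [|b k] //; rewrite ?finite_word1 ?finite_word_cons.
- by move=> /esym e; have [e1 _] := mulw_eq1 e; case: (letter_word_neq1 e1).
- by move=> e; have [e1 _] := mulw_eq1 e; case: (letter_word_neq1 e1).
by move=> e; have [/letter_word_inj -> /ih ->] := mulw_inj e erefl.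
Qed.

Lemma finite_word_cut (l : seq X) p q : finite_word l = p * q ->
  exists l1 l2, [/\ l = l1 ++ l2, p = finite_word l1 & q = finite_word l2].
Proof.
elim: l p => [|a l ih] p.
  rewrite finite_word1 => /esym /mulw_eq1 [-> ->].
  by exists [::], [::]; rewrite finite_word1.
rewrite finite_word_cons => e.
have [p1|p1] := pselect (p = 1).
  exists [::], (a :: l); rewrite finite_word1 p1; split=> //.
  by rewrite finite_word_cons e p1 mul1g.
have [z ep eq] := levi e (wlen_pos p1).
have [l1 [l2 [-> ez ->]]] := ih _ eq.
by exists (a :: l1), l2; rewrite finite_word_cons ep ez.
Qed.

End Letters.

(** * Words with a value in G *)

Section Values.
Variables (G : groupType) (Sigma : set G).
Notation L := (letter Sigma).
Notation W := (word L).
Implicit Types (x y z p q u c : W) (l r : seq L) (g h : G).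

Lemma barM x y : bar (x * y) = bar y * bar x.
Proof. exact: bar_wordM. Qed.
Lemma bar1 : bar (1 : W) = 1.
Proof. exact: bar_word1. Qed.
Lemma barK x : bar (bar x) = x.
Proof. by apply: bar_wordK; apply: letter_invK. Qed.
Lemma wlen_bar x : wlen (bar x) = wlen x.
Proof. by []. Qed.

Lemma eval_cat l r : eval (l ++ r) = eval l * eval r.
Proof. exact: big_cat. Qed.
Lemma eval0 : eval ([::] : seq L) = 1.
Proof. by rewrite /eval big_nil. Qed.
Lemma eval1 (a : L) : eval [:: a] = val a.
Proof. by rewrite /eval big_seq1. Qed.

Lemma factor_reduced f x : factor f x -> G_reduced x -> G_reduced f.
Proof.
move=> [p [q e]] hx l l0 [p' [q' e']]; apply: hx l0 _.
by exists (p * p'), (q' * q); rewrite e e' !mulgA.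
Qed.

Lemma reducedL x y : G_reduced (x * y) -> G_reduced x.
Proof. by apply: factor_reduced; exists 1, y; rewrite mul1g. Qed.

Lemma reducedR x y : G_reduced (x * y) -> G_reduced y.
Proof. by apply: factor_reduced; exists x, 1; rewrite mulg1. Qed.

Lemma reduced_finite l : G_reduced (finite_word l) -> eval l = 1 -> l = [::].
Proof.
move=> hl el; case: l el hl => // a l el hl.
case: (hl (a :: l)) => //; exists 1, 1.
by rewrite mul1g mulg1.
Qed.

(** The last letter of [u] and the first letter of [bar u] would be a finite
    factor equal to 1 in G. *)
Lemma reduced_palindrome p u q : G_reduced (p * u * bar u * q) -> u = 1.
Proof.
move=> h; apply: contrapT => /last_letter [a [u' eu]].
case: (h [:: a; letter_inv a]) => //; last first.
  by rewrite /eval big_cons big_seq1 /= mulgV.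
exists (p * u'), (bar u' * q).
rewrite finite_word_cons finite_word_letter eu barM /bar bar_letter.
by rewrite !mulgA.
Qed.

(** Derivations that a word represents an element of G: nested cancellations
    of reduced words around words of value 1, together with the
    multiplication table of G. The point of this grammar is that a
    derivation can be analysed by structural induction, while the congruence
    that defines E(A,G) can pass through longer and longer words. *)
Inductive value : W -> G -> Prop :=
| value_one : value 1 1
| value_letter (a : L) : value (letter_word a) (val a)
| value_mul x y g h : value x g -> value y h -> value (x * y) (g * h)
| value_conj u x : G_reduced u -> value x 1 -> value (u * x * bar u) 1.

Lemma value_empty g : value 1 g -> g = 1.
Proof.
suff h x : value x g -> x = 1 -> g = 1 by move/h; apply.
elim=> // [a e|x' y' g' h' _ ih1 _ ih2 e].
  by case: (letter_word_neq1 e).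
have [x1 y1] := mulw_eq1 e.
by rewrite (ih1 x1) (ih2 y1) mulg1.
Qed.

Lemma value_bar x g : value x g -> value (bar x) g^-1.
Proof.
elim=> [|a|x' y' g' h' _ ih1 _ ih2|u x' hu _ ih].
- rewrite bar1 invg1; exact: value_one.
- rewrite /bar bar_letter; exact: (value_letter (letter_inv a)).
- by rewrite barM invgM; apply: value_mul.
- rewrite !barM barK invg1 mulgA; apply: value_conj => //.
  by move: ih; rewrite invg1.
Qed.

(** In the case of a cancelled pair [u], [bar u], losing the last letter opens
    the outermost layer of the pair: a letter is left in front of a smaller
    cancelled pair. *)
Lemma value_rstrip x (a : L) g :
  value (x * letter_word a) g -> value x (g * (val a)^-1).
Proof.
suff h y : value y g -> forall x, y = x * letter_word a -> value x (g * (val a)^-1).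
  by move/h; apply.
move=> {x}; elim=> [x|b x|y1 y2 g1 g2 hv1 ih1 hv2 ih2 x|u z hu hz ihz x].
- by move/esym => e; have [_ e2] := mulw_eq1 e; case: (letter_word_neq1 e2).
- move=> e0; case: (letter_word_cut e0) => -[ex e]; last by case: (letter_word_neq1 e).
  by rewrite ex (letter_word_inj e) mulgV; exact: value_one.
- have [y21|/last_letter [b [y2' ey2]]] := pselect (y2 = 1).
    rewrite y21 mulg1; move: hv2; rewrite y21 => /value_empty ->.
    by rewrite mulg1; apply: ih1.
  rewrite ey2 mulgA => e; have [<- eab0] := mulw_injr e erefl.
  have eab := letter_word_inj eab0.
  rewrite -mulgA; apply: value_mul => //; apply: ih2.
  by rewrite ey2 eab.
- have [u1|/first_letter [b [u' eu]]] := pselect (u = 1).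
    by rewrite u1 mul1g bar1 mulg1; apply: ihz.
  rewrite {2}eu barM {2}/bar bar_letter mulgA => e.
  have [<- e0] := mulw_injr e erefl; rewrite -(letter_word_inj e0) /= invgK mul1g.
  rewrite eu -!mulgA -[val b]mulg1; apply: value_mul.
    exact: value_letter.
  rewrite mulgA; apply: value_conj => //.
  by apply: (@reducedR (letter_word b)); rewrite -eu.
Qed.

Lemma value_finite l : value (finite_word l) (eval l).
Proof.
elim: l => [|a l ih]; first by rewrite finite_word1 eval0; exact: value_one.
rewrite finite_word_cons /eval big_cons; apply: value_mul => //.
exact: value_letter.
Qed.

Lemma value_finite_rstrip x l g :
  value (x * finite_word l) g -> value x (g * (eval l)^-1).
Proof.
elim/last_ind: l g => [|l a ih] g.
  by rewrite finite_word1 eval0 invg1 !mulg1.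
rewrite -cats1 finite_word_cat finite_word_letter mulgA => /value_rstrip /ih.
by rewrite eval_cat invgM mulgA eval1.
Qed.

Lemma value_finite_lstrip x l g :
  value (finite_word l * x) g -> value x ((eval l)^-1 * g).
Proof.
move=> /value_bar; rewrite barM /bar bar_finite => /value_finite_rstrip /value_bar.
by rewrite eval_bar -/(bar _) barK invgK invgM invgK.
Qed.

Lemma value_finiteE l g : value (finite_word l) g -> g = eval l.
Proof.
rewrite -[finite_word l]mul1g => /value_finite_rstrip /value_empty.
exact: divg1_eq.
Qed.

Lemma value_word x g : value x g -> exists l, eval l = g.
Proof.
elim=> [|a|x' y' g' h' _ [l1 <-] _ [l2 <-]|u x' _ _ _].
- by exists [::]; rewrite eval0.
- by exists [:: a]; rewrite eval1.
- by exists (l1 ++ l2); rewrite eval_cat.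
- by exists [::]; rewrite eval0.
Qed.

(** By induction the word inside a cancelled pair of a reduced word is finite
    and reduced of value 1, hence empty; then the pair itself is empty by
    [reduced_palindrome]. *)
Lemma value_reduced x g : value x g -> G_reduced x -> exists l, x = finite_word l.
Proof.
elim=> [|a|x' y' g' h' _ ih1 _ ih2|u x' hu hx ih].
- by exists [::]; rewrite finite_word1.
- by exists [:: a]; rewrite finite_word_letter.
- move=> hxy; have [l1 ->] := ih1 (reducedL hxy).
  by have [l2 ->] := ih2 (reducedR hxy); exists (l1 ++ l2); rewrite finite_word_cat.
- move=> hr; have hx' : G_reduced x' := reducedR (reducedL hr).
  have [l el] := ih hx'; move: hx hx' hr; rewrite el => /value_finiteE /esym e1 h1.
  rewrite (reduced_finite h1 e1) finite_word1 mulg1 => h2.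
  have u1 : u = 1.
    by apply: (@reduced_palindrome 1 u 1); rewrite mul1g mulg1.
  by exists [::]; rewrite u1 bar1 finite_word1 mulg1.
Qed.

Lemma value_reduced1 x : value x 1 -> G_reduced x -> x = 1.
Proof.
move=> hx rx; have [l el] := value_reduced hx rx.
move: hx rx; rewrite el => /value_finiteE /esym e1 /reduced_finite -> //.
by rewrite finite_word1.
Qed.

Lemma value_eq1 x g : value x g -> g = 1 -> value x 1.
Proof. by move=> hx <-. Qed.

Lemma value_mul1 x y : value x 1 -> value y 1 -> value (x * y) 1.
Proof. by move=> hx hy; apply: value_eq1 (value_mul hx hy) (mulg1 _). Qed.

(** An insertion inside [u], where [u] is cancelled against [bar u], cuts [u]
    into [u1 * u2] and takes place next to [u2 * x * bar u2], which has value 1. *)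
Lemma value_insert p q z g : value (p * q) g -> value z 1 -> value (p * z * q) g.
Proof.
suff h x : value x g -> value z 1 -> forall p q, x = p * q -> value (p * z * q) g.
  by move=> /h hx /hx; apply.
move=> hx hz; elim: {x g} hx => [|a|x y g h hx ihx hy ihy|u x hu hx ihx] p' q'.
- by move/esym => /mulw_eq1 [-> ->]; rewrite mul1g mulg1.
- have ha := value_letter a.
  move=> e; case: (letter_word_cut e) => -[-> ->].
    by rewrite mul1g -[val a]mul1g; apply: value_mul.
  by rewrite mulg1 -[val a]mulg1; apply: value_mul.
- move=> /leviP [[k -> ey]|[k ex ->]].
    by rewrite -!mulgA; apply: value_mul => //; rewrite mulgA; apply: ihy.
  by rewrite mulgA; apply: value_mul => //; apply: ihx.
- move=> /leviP [[k ep eb]|[k eux eq]].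
    have eu : u = bar q' * bar k by rewrite -[u]barK eb barM.
    rewrite ep eu -[X in _ * X]barK.
    have -> : bar q' * bar k * x * k * z * bar (bar q') =
              bar q' * (bar k * x * bar (bar k) * z) * bar (bar q').
      by rewrite !barK !mulgA.
    apply: value_conj; first by apply: (@reducedL _ (bar k)); rewrite -eu.
    apply: value_mul1 => //.
    by apply: value_conj => //; apply: (@reducedR (bar q')); rewrite -eu.
  move: eux => /leviP [[m ep ex]|[m eu ek]].
    rewrite ep eq.
    have -> : u * m * z * (k * bar u) = u * (m * z * k) * bar u by rewrite !mulgA.
    by apply: value_conj => //; apply: ihx.
  rewrite eq ek eu barM.
  have -> : p' * z * (m * x * (bar m * bar p')) =
            p' * (z * (m * x * bar m)) * bar p' by rewrite !mulgA.
  move: hu; rewrite eu => hu; apply: value_conj; first exact: reducedL hu.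
  apply: value_mul1 => //.
  by apply: value_conj => //; apply: reducedR hu.
Qed.


Lemma value_subst_finite k p l q r :
  finite_word k = p * finite_word l * q -> eval l = eval r ->
  value (p * finite_word r * q) (eval k).
Proof.
move=> /finite_word_cut [k1 [k2 [-> /esym]]].
move=> /finite_word_cut [k3 [k4 [-> -> /finite_word_inj <-]]] -> e.
rewrite -!finite_word_cat; have -> : eval ((k3 ++ l) ++ k2) = eval ((k3 ++ r) ++ k2).
  by rewrite !eval_cat e.
exact: value_finite.
Qed.

(** A finite factor that crosses the border between two subwords with a value
    can be split there and stripped on both sides; if it meets one member of
    a cancelled pair, its mirror image in the other member is stripped too. *)
Lemma value_subst p l q r g : value (p * finite_word l * q) g -> eval l = eval r ->
  value (p * finite_word r * q) g.
Proof.
suff h x : value x g -> forall p l q r, x = p * finite_word l * q ->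
    eval l = eval r -> value (p * finite_word r * q) g.
  by move=> /h; apply.
elim=> {x g p l q r} [|a|x y g h hx ihx hy ihy|u x hu hx ihx] p l q r.
- by rewrite -(@eval0) -finite_word1; apply: value_subst_finite.
- by rewrite -(@eval1) -finite_word_letter; apply: value_subst_finite.
- move=> /leviP [[k epl ey]|[k ex ->]] elr; last first.
    by rewrite mulgA; apply: value_mul => //; apply: ihx elr.
  move: epl => /leviP [[m exm em]|[m ep ekm]].
    (* the replaced factor meets both x and y *)
    have [l1 [l2 [el em1 ek]]] := finite_word_cut em.
    move: hx hy; rewrite exm ey em1 ek => /value_finite_rstrip hp.
    move=> /value_finite_lstrip hq.
    have := value_mul (value_mul hp (value_finite r)) hq.
    by rewrite -elr el eval_cat !mulgA !mulgVK mulgK.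
  rewrite ep -!mulgA; apply: value_mul => //; rewrite mulgA.
  by apply: ihy elr; rewrite ey ekm.
- move=> e elr.
  have bfw (k : seq L) : bar (finite_word k) = finite_word (rev (map (@letter_inv G Sigma) k)).
    exact: bar_finite.
  move: e => /leviP [[k epl ebu]|[k eux eq]].
    have eu : u = bar q * bar k by rewrite -[u]barK ebu barM.
    have rq : G_reduced (bar q) by apply: (@reducedL _ (bar k)); rewrite -eu.
    move: epl => /leviP [[m eux el]|[m ep ek]].
      have [l1 [l2 [ell em ek]]] := finite_word_cut el.
      move: eux => /leviP [[n ep ex]|[n eu' en]].
        rewrite ep eu -{2}[q]barK ek bfw.
        set k' := rev _.
        have -> : bar q * finite_word k' * n * finite_word r * bar (bar q) =
          bar q * (finite_word k' * n * finite_word r) * bar (bar q).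
          by rewrite !mulgA.
        apply: value_conj => //; apply: value_eq1.
          apply: value_mul _ (value_finite _); apply: value_mul (value_finite _) _.
          by apply: (@value_finite_rstrip _ l1 1); rewrite -em -ex.
        by rewrite -elr ell eval_cat eval_bar mul1g !mulgA mulgVK mulVg.
      have [n1 [x1 [el1 en1 ex1]]] : exists n1 x1 : seq L,
          [/\ l1 = n1 ++ x1, n = finite_word n1 & x = finite_word x1].
        by apply: finite_word_cut; rewrite -em.
      have ex1e : eval x1 = 1.
        by move: hx; rewrite ex1 => /value_finiteE ->.
      have := ebu; rewrite eu' barM => /leviP [[j ek' ep]|[j en' eq]].
        have [n1' [j1 [en1' en1'' ej]]] : exists n1' j1 : seq L,
            [/\ l2 = n1' ++ j1, bar n = finite_word n1' & j = finite_word j1].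
          by apply: finite_word_cut; rewrite -ek.
        have -> : p * finite_word r * q =
            bar q * (bar j * finite_word r) * bar (bar q).
          by rewrite -{1}[p]barK ep barM barK !mulgA.
        apply: value_conj => //; rewrite ej bfw; apply: value_eq1.
          by apply: value_mul; exact: value_finite.
        have e1 : eval n1' = (eval n1)^-1.
          apply: esym; rewrite -eval_bar; apply: value_finiteE.
          by rewrite -en1'' en1 bfw; exact: value_finite.
        rewrite -elr ell el1 en1' !eval_cat ex1e mulg1 e1 eval_bar.
        by rewrite !mulgA mulgK mulVg.
      have [l2' [j1 [en1' ek1 ej]]] : exists l2' j1 : seq L,
          [/\ rev (map (@letter_inv G Sigma) n1) = l2' ++ j1, k = finite_word l2' &
              j = finite_word j1].
        by apply: finite_word_cut; rewrite -en' -bfw -en1.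
      have ell2 : l2' = l2 by apply: finite_word_inj; rewrite -ek.
      subst l2'; have -> : p * finite_word r * q = p * (finite_word r * j) * bar p.
        by rewrite eq !mulgA.
      apply: value_conj; first by move: hu; rewrite eu' => /reducedL.
      rewrite ej; apply: value_eq1; first by apply: value_mul; exact: value_finite.
      rewrite -elr ell el1 !eval_cat ex1e mulg1 -mulgA -eval_cat -en1' eval_bar.
      by rewrite mulgV.
    have -> : p * finite_word r * q =
        bar q * (bar (finite_word l) * (bar m * x * bar (bar m)) * finite_word r) *
        bar (bar q).
      by rewrite ep eu ek !barM !barK !mulgA.
    apply: value_conj => //; rewrite bfw; apply: value_eq1.
      apply: value_mul _ (value_finite _); apply: value_mul (value_finite _) _.
      apply: value_conj hx; move: hu; rewrite eu ek barM mulgA.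
      exact: reducedR.
    by rewrite eval_bar elr mulg1 mulVg.
  move: eux => /leviP [[m epl ex]|[m eu ek]].
    move: epl => /esym/leviP [[n ep em]|[n eu el]].
      have -> : p * finite_word r * q = u * (n * finite_word r * k) * bar u.
        by rewrite ep eq !mulgA.
      by apply: value_conj => //; apply: ihx elr; rewrite ex em.
    have [l1 [l2 [ell en em]]] := finite_word_cut el.
    have -> : p * finite_word r * q = p * (finite_word r * k * bar n) * bar p.
      by rewrite eq eu barM !mulgA.
    apply: value_conj; first by move: hu; rewrite eu => /reducedL.
    rewrite en bfw; apply: value_eq1.
      apply: value_mul _ (value_finite _); apply: value_mul (value_finite _) _.
      by apply: (@value_finite_lstrip _ l2 1); rewrite -em -ex.
    by rewrite -elr ell eval_cat eval_bar mulg1 mulgK mulgV.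
  have -> : p * finite_word r * q =
      p * (finite_word r * (m * x * bar m) * bar (finite_word l)) * bar p.
    by rewrite eq ek eu !barM !mulgA.
  have hu' := hu; rewrite eu in hu'.
  apply: value_conj; first exact: reducedL (reducedL hu').
  rewrite bfw; apply: value_eq1.
    apply: value_mul _ (value_finite _); apply: value_mul (value_finite _) _.
    by apply: value_conj hx; apply: reducedR hu'.
  by rewrite eval_bar elr mulg1 mulgV.
Qed.

End Values.

(** * Invariance of the value under the relations of E(A,G) *)

Section Deletion.
Variables (G : groupType) (Sigma : set G).
Notation L := (letter Sigma).
Notation W := (word L).
Implicit Types (x y z p q u c : W) (l r : seq L) (g h : G).

(** If [p * u] has value [g], then [bar u] and [g^-1 * p] are equal in E(A,G);
    the lemma carries out this replacement inside an arbitrary word. The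
    induction is on the derivation for [p * u]. If [p * u] is a cancelled pair
    around [x] and [u] reaches into [x], then the context contains the first
    member of that pair followed by the mirror image of a suffix of [x], so
    the induction hypothesis for [x] applies to the context as it stands. *)
Lemma value_replace p u g s q h l : value (p * u) g -> G_reduced u ->
  value (s * bar u * q) h -> eval l = g^-1 ->
  value (s * finite_word l * p * q) h.
Proof.
suff H x : value x g -> forall p u s q h l, x = p * u -> G_reduced u ->
    value (s * bar u * q) h -> eval l = g^-1 ->
    value (s * finite_word l * p * q) h.
  by move=> hx; apply: H hx _ _ _ _ _ _ erefl.
have ins s' q' k h' : value (s' * q') h' -> eval k = 1 ->
    value (s' * finite_word k * q') h'.
  move=> hv k1; apply: value_insert hv _.
  exact: value_eq1 (value_finite _) k1.
have fin_bar k : bar (finite_word k) = finite_word (rev (map (@letter_inv G Sigma) k)).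
  exact: bar_finite.
elim=> {x g p u s q h l} [|a|x y g1 g2 hx ihx hy ihy|c x hc hx ihx] p u s q h l.
- move=> /esym e; have [-> ->] := mulw_eq1 e.
  by rewrite bar1 !mulg1 => _ hv; rewrite invg1; apply: ins.
- move=> e; case: (letter_word_cut e) => -[-> ->] _.
    rewrite mulg1 /bar bar_letter => hv el.
    have := @value_subst G Sigma s [:: letter_inv a] q l h.
    by rewrite finite_word_letter eval1; apply.
  rewrite bar1 mulg1 => hv el.
  have := @ins s q (l ++ [:: a]) h hv.
  rewrite finite_word_cat finite_word_letter eval_cat eval1 el mulVg.
  by rewrite !mulgA; apply.
- move=> /leviP [[k ep ey]|[k ex eu]] ru hv el.
    have [l2 el2] : exists l, eval l = g2^-1.
      have [l0 el0] := value_word hy.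
      by exists (rev (map (@letter_inv G Sigma) l0)); rewrite eval_bar el0.
    have {}hv := ihy _ _ _ _ _ _ ey ru hv el2.
    have [lx elx] := value_word hx.
    have hlx : value (finite_word (rev (map (@letter_inv G Sigma) lx)) * x) 1.
      apply: value_eq1 (value_mul (value_finite _) hx) _.
      by rewrite eval_bar elx mulVg.
    have : value (s * finite_word l2 *
        (finite_word (rev (map (@letter_inv G Sigma) lx)) * x) * (k * q)) h.
      by apply: value_insert hlx; rewrite mulgA.
    have -> : s * finite_word l2 *
        (finite_word (rev (map (@letter_inv G Sigma) lx)) * x) * (k * q) =
        s * finite_word (l2 ++ rev (map (@letter_inv G Sigma) lx)) * (x * k * q).
      by rewrite finite_word_cat !mulgA.
    move=> /value_subst H; have := H l; rewrite ep !mulgA; apply.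
    by rewrite eval_cat el2 eval_bar elx el invgM.
  have ry : G_reduced y by move: ru; rewrite eu; apply: reducedR.
  have [ly ely] := value_reduced hy ry.
  have eg2 : g2 = eval ly by move: hy; rewrite ely => /value_finiteE.
  have [lx elx] := value_word hx.
  have el1 : eval (rev (map (@letter_inv G Sigma) lx)) = g1^-1.
    by rewrite eval_bar elx.
  move: hv; rewrite eu barM ely fin_bar !mulgA -(mulgA _ (bar k)) mulgA => hv.
  have rk : G_reduced k by move: ru; rewrite eu; apply: reducedL.
  have := ihx _ _ _ _ _ _ ex rk hv el1.
  rewrite -(mulgA s) -finite_word_cat -(mulgA _ p) => /value_subst H.
  have := H l; rewrite !mulgA; apply.
  by rewrite eval_cat el1 eval_bar -eg2 el invgM.
- rewrite invg1 => /leviP [[k ep ec]|[k ecx eu]] ru hv el.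
    have ec' : c = bar u * bar k by rewrite -[c]barK ec barM.
    have : value (s * (finite_word l) * (bar u * q)) h.
      by apply: ins el; rewrite mulgA.
    rewrite mulgA => hv2; have hz : value (bar k * x * bar (bar k)) 1.
      by apply: value_conj hx; move: hc; rewrite ec'; apply: reducedR.
    by have := value_insert hv2 hz; rewrite ep ec' barK !mulgA.
  move: ecx => /leviP [[m ep ex]|[m ec ek]].
    have rk : G_reduced k by move: ru; rewrite eu; apply: reducedL.
    have e0 : eval ([::] : seq L) = 1^-1 by rewrite eval0 invg1.
    move: hv; rewrite eu barM barK mulgA => hv.
    have := ihx _ _ _ _ _ _ ex rk hv e0.
    rewrite finite_word1 mulg1 -!mulgA => /ins /(_ el).
    by rewrite ep !mulgA.
  have rx : G_reduced x.
    by move: ru; rewrite eu ek => /reducedL/reducedR.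
  have x1 := value_reduced1 hx rx.
  have m1 : m = 1.
    apply: (@reduced_palindrome _ _ 1 m (bar p)).
    by move: ru; rewrite eu ek ec x1 barM mulg1 mul1g mulgA.
  move: hv; rewrite eu ek ec x1 m1 !mulg1 mul1g barK -mulgA => /ins /(_ el).
  by rewrite mulgA.
Qed.

(** Values survive the deletion of [u * bar u]: this is the confluence
    property behind the whole proof. In a product cut inside [u], say, the
    inner part of [u] is deleted by induction and the outer part is exchanged
    by [value_replace]. In a cancelled pair around [x], the centre of
    [u * bar u] cannot lie inside a reduced word, so it lies in [x]; then [u] and
    [bar u] each either end within [x] or reach into the members of the pair,
    and in each case a shorter palindrome can be deleted from [x]. *)
Lemma value_cancel p u q g : value (p * u * bar u * q) g -> G_reduced u ->
  value (p * q) g.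
Proof.
suff H x : value x g -> forall p u q, x = p * u * bar u * q -> G_reduced u ->
    value (p * q) g.
  by move=> hx; apply: H hx _ _ _ erefl.
have join p' u' q' g1 h : value (p' * u') g1 -> value (bar u' * q') h ->
    G_reduced u' -> value (p' * q') (g1 * h).
  move=> hp hq ru; have [l0 el0] := value_word hp.
  pose l := rev (map (@letter_inv G Sigma) l0).
  have el : eval l = g1^-1 by rewrite eval_bar el0.
  have := @value_replace p' u' g1 1 q' h l hp ru.
  rewrite mul1g => /(_ hq el); rewrite mul1g -mulgA => /value_finite_lstrip.
  by rewrite el invgK.
elim=> {x g p u q} [|a|x y g1 g2 hx ihx hy ihy|c x hc hx ihx] p u q e ru.
- have [e1 q1] := mulw_eq1 (esym e); have [e2 _] := mulw_eq1 e1.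
  have [p1 _] := mulw_eq1 e2; rewrite p1 q1 mulg1; exact: value_one.
- have u1 : u = 1.
    apply: wlen_lt1; have := congr1 (@wlen _) e; rewrite !wlenM wlen_bar /=.
    have := wlen_ge0 p; have := wlen_ge0 q; move: (wlen p) (wlen q) (wlen u).
    by move=> a0 b0 c0; lra.
  move: e; rewrite u1 bar1 !mulg1 => <-; exact: value_letter.
- move: e; rewrite -(mulgA (p * u)) => /leviP [[k epu ey]|[k ex ebu]].
    move: epu => /esym/leviP [[m ep ek]|[m ex eu]].
      rewrite ep -mulgA; apply: value_mul => //; apply: ihy ru.
      by rewrite ey ek !mulgA.
    move: ru; rewrite eu => ru; apply: (join p m q) => //; last exact: reducedL ru.
      by rewrite -ex.
    rewrite -[bar m * q]mul1g; apply: (ihy 1 k); last exact: reducedR ru.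
    by rewrite ey eu barM mul1g !mulgA.
  move: ebu => /leviP [[m ek eq]|[m eu ey]].
    rewrite eq mulgA; apply: value_mul => //; apply: ihx ru.
    by rewrite ex ek !mulgA.
  have eu' : u = bar m * bar k by rewrite -[u]barK eu barM.
  move: ru; rewrite eu' => ru.
  apply: (join p (bar m) q) => //; last exact: reducedL ru.
    rewrite -[p * bar m]mulg1; apply: (ihx _ (bar k)); last exact: reducedR ru.
    by rewrite ex eu' barK mulg1 !mulgA.
  by rewrite barK -ey.
- have [u1|un1] := pselect (u = 1).
    by move: e; rewrite u1 bar1 !mulg1 => <-; apply: value_conj.
  (* the centre of u * bar u lies in x, as it cannot lie inside c or bar c *)
  have [k epu exc] : exists2 k, p * u = c * k & x * bar c = k * (bar u * q).
    move: e; rewrite -(mulgA (p * u)) -(mulgA c) => /leviP [[k -> ->]|[k ec ebu]].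
      by exists k.
    suff k1 : k = 1.
      by exists 1; rewrite ?ec ?ebu k1 !mulg1 ?mul1g // ec k1 mulg1.
    move: ebu => /leviP [[m ek _]|[m ebu _]].
      case: un1; apply: (@reduced_palindrome _ _ p u m).
      by rewrite -mulgA -ek -ec.
    have bk1 : bar k = 1; last by rewrite -[k]barK bk1 bar1.
    apply: (@reduced_palindrome _ _ (p * bar m) (bar k) 1).
    by move: hc; rewrite ec barK mulg1 -{1}[u]barK ebu barM mulgA.
  have [k' ex ebu] : exists2 k', x = k * k' & bar u * q = k' * bar c.
    move: exc => /leviP [[m ek ebc]|[k' ex ebu]]; last by exists k'.
    suff m1 : m = 1.
      by exists 1; rewrite ?ek ?m1 ?mulg1 // ebc m1 !mul1g.
    move: epu; rewrite ek mulgA => /leviP [[n _ eu]|[n _ em]].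
      apply: (@reduced_palindrome _ _ 1 m (bar n * q)).
      by have := G_reduced_bar hc; rewrite -/(bar c) ebc eu barM mul1g !mulgA.
    case: un1; apply: (@reduced_palindrome _ _ n u q).
    by have := G_reduced_bar hc; rewrite -/(bar c) ebc em !mulgA.
  have rbc := G_reduced_bar hc; rewrite -/(bar c) in rbc.
  (* a null product may be permuted cyclically across reduced factors *)
  have rot v z : G_reduced v -> value (z * v) 1 -> value (v * z) 1.
    move=> rv hzv; have e0 : eval ([::] : seq L) = 1^-1 by rewrite eval0 invg1.
    have := @value_replace z v 1 v 1 1 [::] hzv rv.
    rewrite finite_word1 !mulg1; apply=> //.
    have := value_conj rv (value_one Sigma); rewrite mulg1; apply.
  have rot' v z : G_reduced v -> value (v * z) 1 -> value (z * v) 1.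
    move=> rv /value_bar; rewrite invg1 barM => /(rot _ _ (G_reduced_bar rv)).
    by move=> /value_bar; rewrite invg1 barM -/(bar v) !barK.
  move: epu => /leviP [[c1 ec eu]|[p' ep ek]].
    move: ru; rewrite eu => ru; have rk := reducedR ru.
    have rc1 := reducedL ru; have rp : G_reduced p.
      by move: hc; rewrite ec; apply: reducedL.
    move: ebu => /leviP [[q' ek' eq]|[q1 ebu ebc]].
      have -> : p * q = p * (q' * bar c1) * bar p by rewrite eq ec barM !mulgA.
      apply: value_conj => //; apply: rot'; first exact: G_reduced_bar.
      rewrite -[bar c1 * q']mul1g; apply: (ihx 1 k) => //.
      by rewrite ex ek' eu barM mul1g !mulgA.
    suff eq1 : q1 = bar c1.
      move: ebc; rewrite ec barM eq1 => /mulwI <-.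
      by have := value_conj rp (value_one Sigma); rewrite mulg1.
    move: ebu; rewrite eu barM => /leviP [[m ek' ec1]|[m ebk eq1]].
      suff m1 : m = 1 by rewrite ec1 m1 mul1g.
      apply: value_reduced1; last first.
        by have := G_reduced_bar rc1; rewrite -/(bar c1) ec1; apply: reducedL.
      rewrite -[m]mul1g; apply: (ihx 1 k) => //.
      by rewrite ex ek' mul1g mulgA.
    suff m1 : bar m = 1 by rewrite eq1 -[m]barK m1 bar1 mul1g.
    have ek : k = bar m * bar k' by rewrite -[k]barK ebk barM.
    apply: value_reduced1; last by move: rk; rewrite ek; apply: reducedL.
    rewrite -[bar m]mulg1; apply: (ihx _ (bar k')); last first.
      by move: rk; rewrite ek; apply: reducedR.
    by rewrite ex ek barK mulg1.
  move: ebu => /leviP [[q' ek' eq]|[q1 ebu ebc]].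
    rewrite ep eq.
    have -> : c * p' * (q' * bar c) = c * (p' * q') * bar c by rewrite !mulgA.
    apply: value_conj => //; apply: ihx ru.
    by rewrite ex ek ek' !mulgA.
  have eu : u = bar q1 * bar k' by rewrite -[u]barK ebu barM.
  have ec : c = bar q * bar q1 by rewrite -[c]barK ebc barM.
  have -> : p * q = bar q * (bar q1 * p') * bar (bar q).
    by rewrite ep ec barK !mulgA.
  move: ru; rewrite eu => ru.
  apply: value_conj; first by move: hc; rewrite ec; apply: reducedL.
  apply: rot; first exact: reducedL ru.
  rewrite -[p' * _]mulg1; apply: (ihx _ (bar k')); last exact: reducedR ru.
  by rewrite ex ek eu barK mulg1 !mulgA.
Qed.

(** Each defining relation inserts or deletes a word of value 1. *)
Lemma value_cong x y p q g : cong (@M_rel G Sigma) x y ->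
  value (p * x * q) g <-> value (p * y * q) g.
Proof.
move=> exy; elim: exy p q g => {x y}
  [x y [u l r ru elr]|x|x y _ ih|x y z _ ih1 _ ih2|x x' y y' _ ih1 _ ih2] p q g //.
- rewrite mulg1.
  have fin_bar : bar (finite_word r) = finite_word (rev (map (@letter_inv G Sigma) r)).
    exact: bar_finite.
  have hlr : value (finite_word l * bar (finite_word r)) 1.
    rewrite fin_bar; apply: value_eq1; first by apply: value_mul; apply: value_finite.
    by rewrite eval_bar elr mulgV.
  split=> [|h]; last first.
    apply: (value_insert h).
    by rewrite -(mulgA u); apply: value_conj.
  rewrite fin_bar -(mulgA u) -finite_word_cat.
  have -> : p * (u * finite_word (l ++ rev (map (@letter_inv G Sigma) r)) * bar u) * q
    = (p * u) * finite_word (l ++ rev (map (@letter_inv G Sigma) r)) * (bar u * q).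
    by rewrite !mulgA.
  have e0 : eval (l ++ rev (map (@letter_inv G Sigma) r)) = eval ([::] : seq L).
    by rewrite eval_cat eval_bar elr mulgV eval0.
  move=> h; have := value_subst h e0; rewrite finite_word1 mulg1 mulgA => {}h.
  exact: value_cancel h ru.
- by split=> h; apply/ih.
- by split=> h; [apply/ih2/ih1 | apply/ih1/ih2].
- rewrite !mulgA -(mulgA _ y) -(mulgA _ y').
  have e a b c d : a * (b * c) * d = (a * b) * c * d :> W by rewrite !mulgA.
  split.
    move=> /(ih1 p (y * q) g) h; rewrite mulgA.
    have := ih2 (p * x') q g; rewrite -!mulgA => h2.
    by move: h; rewrite -!mulgA => /h2.
  move=> h; apply/(ih1 p (y * q) g); rewrite mulgA.
  have := ih2 (p * x') q g; rewrite -!mulgA => h2.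
  by move: h; rewrite -!mulgA => /h2.
Qed.

Lemma M_class_value x y g : M_class x = M_class y -> value x g <-> value y g.
Proof.
move=> /class_ofP /(value_cong 1 1 g).
by rewrite !mul1g !mulg1.
Qed.

Lemma M_classM x y : M_class (x * y) = M_class x * M_class y.
Proof. exact: class_ofM. Qed.

Lemma value_M_class x : value x 1 -> M_class x = 1.
Proof.
have fin l : eval l = 1 -> M_class (finite_word l) = 1.
  move=> el; apply/class_ofP; apply: cong_rel.
  have r1 : G_reduced (1 : W).
    move=> k k0 [p [q /esym /mulw_eq1 [/mulw_eq1 [_ e] _]]].
    by case: k0; apply: finite_word_inj; rewrite e finite_word1.
  have := @M_rel_intro G Sigma 1 l [::] r1.
  by rewrite eval0 finite_word1 -/(bar 1) !bar1 !mulg1 mul1g; apply.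
suff h g y : value y g -> exists l, eval l = g /\ M_class y = M_class (finite_word l).
  by move=> /h [l [/fin <- ->]].
elim=> [|a|y' z' g' h' _ [l1 [<- e1]] _ [l2 [<- e2]]|u z hu _ [l [/fin el ez]]].
- by exists [::]; rewrite eval0 finite_word1.
- by exists [:: a]; rewrite eval1 finite_word_letter.
- by exists (l1 ++ l2); rewrite eval_cat finite_word_cat !M_classM e1 e2.
- exists [::]; rewrite eval0 finite_word1; split=> //.
  by rewrite !M_classM ez el mulg1 M_class_barr.
Qed.

End Deletion.

(** * Cancellation between long syllables *)

Section Small.
Variable X : Type.
Implicit Types x y : word X.

(** Words of degree below [D]. They form a submonoid closed under factors and
    serve as error terms next to words of length 'X^D. *)
Definition small (D : nat) (x : word X) : bool := zsize (wlen x) <= D.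

Lemma smallM D x y : small D (x * y) = small D x && small D y.
Proof. by rewrite /small wlenM zsizeD ?wlen_ge0 // geq_max. Qed.

Lemma small1 D : small D (1 : word X).
Proof. by rewrite /small wlen1 /zsize size_poly0. Qed.

Lemma small_letter D (a : X) : 0 < D -> small D (letter_word a).
Proof. by move=> D0; rewrite /small /= /zsize size_poly1. Qed.

Lemma small_split D x y : wlen (x * y) = ('X^D)%R -> small D x || small D y.
Proof.
by move=> e; apply/orP; apply: zXn_split e; apply: wlen_ge0.
Qed.
End Small.

Section Pairing.
Variables (G : groupType) (Sigma : set G) (D : nat).
Hypothesis D_gt0 : 0 < D.
Notation L := (letter Sigma).
Notation W := (word L).
Implicit Types (x y z p q u c f : W) (g : G).

Lemma small_bar x : small D (bar x) = small D x.
Proof. by []. Qed.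

(** Among the cancelled pairs of a derivation that are not small, take an
    innermost one. *)
Lemma value_pairing x g : value x g -> ~~ small D x ->
  exists p f c q, [/\ x = p * f * c * bar f * q, G_reduced f, ~~ small D f,
    small D c & value c 1].
Proof.
elim=> {x g} [|a|x y g h _ ihx _ ihy|u x hu hx ihx].
- by rewrite small1.
- by rewrite small_letter.
- rewrite smallM negb_and => /orP[/ihx|/ihy] [p [f [c [q [-> h1 h2 h3 h4]]]]].
    by exists p, f, c, (q * y); rewrite !mulgA.
  by exists (x * p), f, c, q; rewrite !mulgA.
- have [sx|/ihx] := boolP (small D x).
    rewrite !smallM small_bar sx andbT andbb => su.
    by exists 1, u, x, 1; rewrite mul1g mulg1.
  move=> [p [f [c [q [-> h1 h2 h3 h4]]]]] _.
  by exists (u * p), f, c, (q * bar u); rewrite !mulgA.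
Qed.

Variables (K : Type) (wd : K -> W) (S : bool -> W).
Hypothesis wd_small : forall k, small D (wd k).
Hypothesis S_len : forall e, wlen (S e) = ('X^D)%R.

(** The word spelled by a product of base elements and powers of the stable
    letter; [S true] and [S false] stand for the stable letter and its inverse. *)
Fixpoint spell (k : K) (s : seq (bool * K)) : W :=
  match s with
  | [::] => wd k
  | (e, k') :: s' => wd k * S e * spell k' s'
  end.

Lemma S_big e : ~~ small D (S e).
Proof. by rewrite /small S_len zsize_Xn ltnn. Qed.

Lemma S_cut e x y : S e = x * y -> small D x || small D y.
Proof. by move=> exy; apply: small_split; rewrite -exy S_len. Qed.

Lemma S_cutl e x y : S e = x * y -> ~~ small D x -> small D y.
Proof. by move=> /S_cut /orP[->|]. Qed.

Lemma S_cutr e x y : S e = x * y -> ~~ small D y -> small D x.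
Proof. by move=> /S_cut /orP[//|->]. Qed.

(** No syllable [S e] splits into two long parts, so a cut with long words on
    both sides lies close to some base element [h]: the cut only displaces
    short ends [b], [b'] of the syllables around [h]. *)
Lemma spell_cut k s Y Z : spell k s = Y * Z -> ~~ small D Y -> ~~ small D Z ->
  exists s1 e h e' h' s2 Y0 x b b' x' Z0 y z,
    [/\ s = s1 ++ (e, h) :: (e', h') :: s2,
        S e = x * b /\ S e' = b' * x', small D b /\ small D b',
        Y = Y0 * x * y /\ Z = z * x' * Z0 & y * z = b * wd h * b'].
Proof.
elim: s k Y => [|[e h] s ih] k Y /=.
  by move=> e bY; have := wd_small k; rewrite e smallM (negbTE bY).
rewrite -mulgA => /leviP [[Y' eY eSX]|[m em _]] bY bZ; last first.
  by have := wd_small k; rewrite em smallM (negbTE bY).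
have bY' : ~~ small D Y' by move: bY; rewrite eY smallM wd_small.
move: eSX => /leviP [[m eY' eX]|[m eSe eZ]]; last first.
  have sm : small D m := S_cutl eSe bY'.
  case: s eZ {ih} => [|[e' h'] s2] /= eZ.
    by move: bZ; rewrite eZ smallM sm wd_small.
  exists [::], e, h, e', h', s2, (wd k), Y', m, 1, (S e'), (spell h' s2), 1, (m * wd h).
  by rewrite !mulg1 !mul1g small1 eZ !mulgA.
have [sm|bm] := boolP (small D m); last first.
  have [s1 [e1 [h1 [e' [h' [s2 [Y0 [x [b [b' [x' [Z0 [y [z
    [es eS sb [eY0 eZ] eyz]]]]]]]]]]]]]]] := ih h m eX bm bZ.
  exists ((e, h) :: s1), e1, h1, e', h', s2, (wd k * S e * Y0), x, b, b', x', Z0, y, z.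
  by rewrite es eY eY' eY0 !mulgA.
case: s eX {ih} => [|[e' h'] s2] /= eX.
  by move: bZ; have := wd_small h; rewrite eX smallM => /andP[_ ->].
move: eX; rewrite -mulgA => /esym/leviP [[n ewd eZ]|[n em eSX]].
  exists [::], e, h, e', h', s2, (wd k), (S e), 1, 1, (S e'), (spell h' s2), m, n.
  by rewrite !mulg1 !mul1g small1 eZ ewd eY eY' !mulgA.
have sn : small D n by move: sm; rewrite em smallM => /andP[].
move: eSX => /esym/leviP [[r eSe' eZ]|[r en _]]; last first.
  by move: sn; rewrite en smallM (negbTE (S_big e')).
exists [::], e, h, e', h', s2, (wd k), (S e), 1, n, r, (spell h' s2), m, 1.
by rewrite !mulg1 !mul1g small1 sn eZ em eY eY' em eSe' !mulgA.
Qed.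

(** The analogue of Britton's lemma at the level of words. A long innermost
    cancelled pair is centred near some [h] by [spell_cut]. Aligning its two
    members with the syllables on both sides of [h], and shortening it where
    it sticks out of one of them, leaves a long factor of the first syllable
    cancelled against a factor of the second. *)
Lemma spell_pinch k s : s <> [::] -> value (spell k s) 1 ->
  exists s1 e h e' h' s2 a f b b' a',
    [/\ s = s1 ++ (e, h) :: (e', h') :: s2,
        S e = a * f * b /\ S e' = b' * bar f * a',
        [/\ small D a, small D b, small D b' & small D a'],
        G_reduced f /\ ~~ small D f & value (b * wd h * b') 1].
Proof.
move=> s0 hv.
have big : ~~ small D (spell k s).
  by case: s s0 {hv} => // -[e h] s _ /=; rewrite !smallM (negbTE (S_big e)) andbF.
have [p [f [c [q [espell rf bf sc vc]]]]] := value_pairing hv big.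
have [|||s1 [e [h [e' [h' [s2 [Y0 [x [b [b' [x' [Z0 [y [z
  [es [eS eS'] [sb sb'] [eY eZ] eyz]]]]]]]]]]]]]]] :=
  @spell_cut k s (p * f) (c * bar f * q).
- by rewrite espell !mulgA.
- by rewrite smallM (negbTE bf) andbF.
- by rewrite !smallM small_bar (negbTE bf) andbF.
have bx : ~~ small D x by have := S_big e; rewrite eS smallM sb andbT.
have bx' : ~~ small D x' by have := S_big e'; rewrite eS' smallM sb'.
have /andP[sy sz] : small D y && small D z.
  by rewrite -smallM eyz !smallM sb sb' wd_small.
(* the part f1 of f inside S e *)
have [a [f1 [k0 [ex ef bf1]]]] : exists a f1 k0,
    [/\ x = a * f1, f = k0 * f1 * y & ~~ small D f1].
  move: eY => /leviP [[m eYx ef]|[m _ ey]]; last first.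
    by move: sy; rewrite ey smallM (negbTE bf) andbF.
  have bm : ~~ small D m by move: bf; rewrite ef smallM sy andbT.
  move: eYx => /esym/leviP [[n _ em]|[n _ ex]].
    by exists 1, x, n; rewrite mul1g ef em.
  by exists n, m, 1; rewrite mul1g.
exists s1, e, h, e', h', s2.
have rf1 : G_reduced f1 by move: rf; rewrite ef => /reducedL/reducedR.
have ry : G_reduced y by move: rf; rewrite ef => /reducedR.
pose C := c * bar y.
have sC : small D C by rewrite smallM sc small_bar.
have vC : value (y * C) 1 by rewrite mulgA; apply: value_conj.
have sa (a1 f2 b1 : W) : S e = a1 * f2 * b1 -> ~~ small D f2 -> small D a1.
  by rewrite -mulgA => /S_cutr H bf2; apply: H; rewrite smallM (negbTE bf2).
have sa' (a1 f2 b1 : W) : S e' = a1 * f2 * b1 -> ~~ small D f2 -> small D b1.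
  by move=> /S_cutl H bf2; apply: H; rewrite smallM (negbTE bf2) andbF.
have eZ' : z * (x' * Z0) = C * (bar f1 * (bar k0 * q)).
  by rewrite mulgA -eZ ef !barM /C !mulgA.
move: eZ' => /leviP [[m eC ex'Z]|[m ez ef1Q]].
  have sm : small D m by move: sC; rewrite eC smallM => /andP[].
  have mid : value (b * wd h * (b' * m)) 1.
    by rewrite mulgA -eyz -mulgA -eC.
  move: ex'Z => /leviP [[t em _]|[t ex' ef1]].
    by move: sm; rewrite em smallM (negbTE bx').
  move: ef1 => /leviP [[r et _]|[r ef1 _]].
    have eS2 : S e' = (b' * m) * bar f1 * r by rewrite eS' ex' et !mulgA.
    exists a, f1, b, (b' * m), r; split=> //; first by rewrite eS ex.
    by split=> //; [apply: (sa _ f1 b); rewrite ?eS ?ex|rewrite smallM sb'|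
                    apply: sa' eS2 _].
  have eS1 : S e = (a * bar r) * bar t * b.
    by rewrite eS ex -[f1]barK ef1 barM !mulgA.
  have bt : ~~ small D (bar t) by rewrite small_bar; move: bx'; rewrite ex' smallM sm.
  exists (a * bar r), (bar t), b, (b' * m), 1; split=> //.
  - by rewrite barK mulg1 eS' ex' !mulgA.
  - by split=> //; [apply: sa eS1 _|rewrite smallM sb'|rewrite small1].
  - split=> //; apply: G_reduced_bar.
    by have := G_reduced_bar rf1; rewrite -/(bar f1) ef1 => /reducedL.
have sm : small D m by move: sz; rewrite ez smallM => /andP[].
move: ef1Q => /leviP [[t em _]|[t ef1 ex'Z]].
  by move: sm; rewrite em smallM small_bar (negbTE bf1).
have ef1' : f1 = bar t * bar m by rewrite -[f1]barK ef1 barM.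
have bt : ~~ small D t.
  by move: bf1; rewrite ef1' smallM !small_bar sm andbT.
have mid : value (bar m * b * wd h * b') 1.
  rewrite -!mulgA (mulgA b) -eyz ez.
  have -> : bar m * (y * (C * m)) = bar m * (y * C) * bar (bar m).
    by rewrite barK !mulgA.
  by apply: value_conj => //; move: rf1; rewrite ef1' => /reducedR.
have rbt : G_reduced (bar t) by move: rf1; rewrite ef1' => /reducedL.
move: ex'Z => /leviP [[r et _]|[r ex' _]].
  have eS1 : S e = (a * bar r) * bar x' * (bar m * b).
    by rewrite eS ex ef1' et barM !mulgA.
  exists (a * bar r), (bar x'), (bar m * b), b', 1; split=> //.
  - by rewrite barK mulg1.
  - by split=> //; [apply: sa eS1 _|rewrite smallM small_bar sm|rewrite small1].
  - by split=> //; move: rbt; rewrite et barM => /reducedR.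
have eS1 : S e = a * bar t * (bar m * b) by rewrite eS ex ef1' !mulgA.
have eS2 : S e' = b' * t * r by rewrite eS' ex' !mulgA.
exists a, (bar t), (bar m * b), b', r; split=> //.
- by rewrite barK.
- by split=> //; [apply: sa eS1 _|rewrite smallM small_bar sm|apply: sa' eS2 _].
Qed.

End Pairing.

(** * Periodic words *)

Section Periodic.
Variable X : Type.
Implicit Types p x y z w : word X.

Lemma pow_cut w j x y : w ^+ j.+1 = x * y -> exists i r r' m,
  [/\ x = w ^+ i * r, w = r * r' & y = r' * w ^+ m].
Proof.
elim: j x => [|j ih] x.
  rewrite expg1 -[w in LHS]mulg1 => /leviP [[z ex /esym ezy]|[z ew ey]].
    have [z1 y1] := mulw_eq1 ezy.
    by exists 0, w, 1, 0; rewrite ex z1 y1 !expg0 !mulg1 mul1g.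
  by exists 0, x, z, 0; rewrite !expg0 mul1g ey.
rewrite expgS => /leviP [[z ex /ih [i [r [r' [m [ez ew ey]]]]]]|[z ew ey]].
  by exists i.+1, r, r', m; rewrite ex ez expgS mulgA.
by exists 0, x, z, j.+1; rewrite expg0 mul1g.
Qed.

(** Reaching the first beginning of a period costs at most one period. *)
Lemma factor_pow_contains w j k y : factor y (w ^+ j) ->
  wlen y = (wlen w *+ k.+1)%R -> exists r r', y = r * w ^+ k * r'.
Proof.
move=> [x [z]]; have [w1|/wlen_pos w1] := pselect (w = 1).
  by exists y, 1; rewrite w1 expg1n !mulg1.
case: j => [/esym e ly|j].
  have [e1 _] := mulw_eq1 e; have [_ y1] := mulw_eq1 e1; exfalso.
  move: ly; rewrite y1 wlen1 => /esym/eqP; rewrite mulrn_eq0 /= => /eqP e0.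
  by rewrite e0 ler10 in w1.
rewrite -mulgA => /pow_cut [i [r [r' [m [_ ew eyz]]]]] ly.
have lw : wlen w = (wlen r + wlen r')%R by rewrite ew.
have lr := wlen_ge0 r; have lr' := wlen_ge0 r'.
have lk : (0 <= wlen w *+ k)%R by rewrite mulrn_wge0 // wlen_ge0.
have [t ey et] : exists2 t, y = r' * t & w ^+ m = t * z.
  by apply: levi (esym eyz) _; rewrite ly mulrS; lra.
have lt : (wlen w *+ k <= wlen t)%R.
  by move: ly; rewrite ey wlenM mulrS => h; lra.
have km : k <= m.
  rewrite leqNgt; apply/negP => mk.
  have l1 : (wlen t <= wlen w *+ m)%R.
    by rewrite -wlenX et wlenM lerDl wlen_ge0.
  have l2 : (wlen w *+ m.+1 <= wlen w *+ k)%R.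
    by apply: ler_wpMn2l mk; rewrite wlen_ge0.
  move: l2; rewrite mulrS => l2.
  have w1' : (0 < wlen w)%R := lt_le_trans ltr01 w1.
  lra.
move: et; rewrite -(subnKC km) expgnDr => et.
have [t' et' _] : exists2 t', t = w ^+ k * t' & w ^+ (m - k) = t' * z.
  by apply: levi et _; rewrite wlenX.
by exists r', t'; rewrite ey et' mulgA.
Qed.

Lemma factor_pow_square w j y : factor y (w ^+ j) -> (wlen y <= wlen w)%R ->
  factor y (w * w).
Proof.
move=> [x [z]]; case: j => [/esym e ly|j].
  have [e1 _] := mulw_eq1 e; have [_ y1] := mulw_eq1 e1.
  by exists 1, (w * w); rewrite y1 !mul1g.
rewrite -mulgA => /pow_cut [i [r [r' [m [_ ew eyz]]]]] ly.
have : (r' * w) * (w ^+ m) = y * (z * w).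
  by rewrite mulgA eyz -!mulgA -expgS -expgSr.
move=> /esym/levi [|t et _]; first by rewrite wlenM ler_wpDl ?wlen_ge0.
by exists r, t; rewrite {1}ew -!mulgA et.
Qed.

(** The extension of [p] with period [wlen p] to all positions that a multiple
    of [wlen p] moves into [p]; elsewhere the value is [d]. Passing to
    [{classic X}] only serves to choose the letter. *)
Definition periodic (d : X) (p : word X) (b : Zt) : X :=
  @xget {classic X} d [set a : X | exists (q : int) h, a = p (exist _ (b - wlen p *~ q)%R h)].

Lemma periodicD d p b : periodic d p (b + wlen p)%R = periodic d p b.
Proof.
rewrite /periodic; congr (@xget {classic X} d _); apply/seteqP; split=> a /= [q [h ->]].
  exists (q - 1)%R; have e : (b - wlen p *~ (q - 1) = b + wlen p - wlen p *~ q)%R.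
    by rewrite mulrzBr mulr1z; ring.
  have h' : (1 <= b - wlen p *~ (q - 1) <= wlen p)%R by rewrite e.
  by exists h'; move: (h') h; rewrite e => h1 h2; apply: wfun_irr.
exists (q + 1)%R; have e : (b + wlen p - wlen p *~ (q + 1) = b - wlen p *~ q)%R.
  by rewrite mulrzDr mulr1z; ring.
have h' : (1 <= b + wlen p - wlen p *~ (q + 1) <= wlen p)%R by rewrite e.
by exists h'; move: (h') h; rewrite e => h1 h2; apply: wfun_irr.
Qed.

Lemma periodicMn d p b n : periodic d p (b + wlen p *+ n)%R = periodic d p b.
Proof.
elim: n => [|n ih]; first by rewrite mulr0n addr0.
by rewrite mulrSr addrA periodicD.
Qed.

Lemma periodic_in d p b h : periodic d p b = p (exist _ b h).
Proof.
apply: (@xget_unique {classic X}) => /= [|a [q [h' ->]]].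
  exists 0%R; have e : (b - wlen p *~ 0 = b)%R by rewrite mulr0z subr0.
  have h' : (1 <= b - wlen p *~ 0 <= wlen p)%R by rewrite e.
  by exists h'; move: (h'); rewrite e => h1; apply: wfun_irr.
have q0 : q = 0%R.
  have p0 : (0 < wlen p)%R.
    by case/andP: h => b1 bp; apply: lt_le_trans (le_trans b1 bp); exact: ltr01.
  have l1 : (wlen p *~ q < wlen p *~ 1)%R.
    by rewrite mulr1z; case/andP: h => ? ?; case/andP: h' => ? ?; lra.
  have l2 : (wlen p *~ (-1) < wlen p *~ q)%R.
    by rewrite mulrNz mulr1z; case/andP: h => ? ?; case/andP: h' => ? ?; lra.
  by move: l1 l2; rewrite !ltr_pMz2l //; lia.
subst q; move: h'; rewrite mulr0z subr0 => h'; exact: wfun_irr.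
Qed.

Lemma word_seg d p : p = wseg (periodic d p) 0%R (wlen_ge0 p).
Proof.
apply: word_ext => // b h1 h2 /=; rewrite add0r; symmetry; exact: periodic_in.
Qed.

Lemma pow_seg d p n (h : (0 <= wlen p *+ n)%R) :
  p ^+ n = wseg (periodic d p) 0%R h.
Proof.
elim: n h => [|n ih] h.
  by rewrite expg0; symmetry; apply: wlen_eq0 => /=; rewrite mulr0n.
have h' : (0 <= wlen p *+ n)%R by rewrite mulrn_wge0 // wlen_ge0.
have h'' : (0 <= wlen p + wlen p *+ n)%R by rewrite addr_ge0 // wlen_ge0.
rewrite expgS (ih h') {1}(word_seg d p).
have -> : wseg (periodic d p) 0%R h' = wseg (periodic d p) (0 + wlen p)%R h'.
  by apply: eq_wseg => b _; rewrite -periodicD; congr periodic; ring.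
rewrite (wsegM _ _ _ _ h''); move: h''; rewrite -mulrS => h''.
by rewrite (bool_irrelevance h'' h).
Qed.

End Periodic.

(** * The word of the stable letter *)

Section StableWord.
Variables (X : Type) (d : X) (D : nat) (u v w : word X).
Hypotheses (len_u : wlen u = wlen w) (len_v : wlen v = wlen w).
Hypotheses (w_neq1 : w <> 1) (w_lt : zsize (wlen w) < D).
Implicit Types (x y f : word X) (b : Zt).

Local Notation n := (zsize (wlen w)).

(** The part of degree at most the degree of [wlen w]. Positions with the same
    remaining part are exactly those that are connected by steps bounded by
    multiples of [wlen w]. *)
Definition low b : Zt := take_poly n (b : {poly int}).

Lemma lowD b b' : low (b + b')%R = (low b + low b')%R.
Proof. exact: take_polyD. Qed.

Lemma low_id b : zsize b <= n -> low b = b.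
Proof. exact: take_poly_id. Qed.

Lemma low_Xn : low ('X^D)%R = 0%R.
Proof.
rewrite /low -(subnK (ltnW w_lt)) exprD; exact: take_polyMXn_0.
Qed.

Lemma zsize_low b : zsize (low b) <= n.
Proof. exact: size_take_poly. Qed.

(** The letter at [b] depends on the class of [b], that is on [b - low b]: the
    class of 0 carries [u], the class of 'X^D carries [v] and all others carry
    [w], each repeated periodically in both directions. *)
Definition stable_letter b : X :=
  periodic d (if (b == low b)%R then u else if (b == 'X^D + low b)%R then v else w)
    (low b).

Definition stable_word : word X := wseg stable_letter 0%R (ltW (zXn_gt0 D)).

Lemma stable_letterD b : stable_letter (b + wlen w)%R = stable_letter b.
Proof.
rewrite /stable_letter lowD (low_id (leqnn _)) addrA !(inj_eq (addIr (wlen w))).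
have per p c : wlen p = wlen w -> periodic d p (c + wlen w)%R = periodic d p c.
  by move=> <-; apply: periodicD.
by case: ifP => _; [|case: ifP => _]; apply: per.
Qed.

Lemma zsize_segment b x : (1 <= b <= wlen x)%R -> zsize b <= zsize (wlen x).
Proof.
by case/andP=> b1 bx; apply: zsize_le bx; apply: le_trans b1; exact: ler01.
Qed.

(** Both sides read the function [stable_letter] from position 1 on: it starts
    with [u], has period [wlen w], and continues with [v] after 'X^D. *)
Lemma stable_conj : u * stable_word = stable_word * v.
Proof.
have eu : u = wseg stable_letter 0%R (wlen_ge0 u).
  apply: word_ext => // b h1 h2 /=; rewrite add0r /stable_letter low_id.
    by rewrite eqxx; symmetry; apply: periodic_in.
  by rewrite -len_u zsize_segment.
have ev : v = wseg stable_letter (0 + 'X^D)%R (wlen_ge0 v).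
  apply: word_ext => // b h1 h2 /=; rewrite add0r /stable_letter.
  rewrite lowD low_Xn add0r low_id; last by rewrite -len_v zsize_segment.
  rewrite eqxx -subr_eq0 addrK (gt_eqF (zXn_gt0 D)).
  by symmetry; apply: periodic_in.
have es : stable_word = wseg stable_letter (0 + wlen u)%R (ltW (zXn_gt0 D)).
  by apply: eq_wseg => b _; rewrite len_u -stable_letterD; congr stable_letter; ring.
have h : (0 <= wlen u + 'X^D :> Zt)%R by rewrite addr_ge0 ?wlen_ge0 // ltW ?zXn_gt0.
have h' : (0 <= 'X^D + wlen v :> Zt)%R by rewrite addr_ge0 ?wlen_ge0 // ltW ?zXn_gt0.
have -> : u * stable_word = wseg stable_letter 0%R h.
  by rewrite es {1}eu; apply: wsegM.
have -> : stable_word * v = wseg stable_letter 0%R h'.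
  by rewrite {1}ev; apply: wsegM.
move: h h'; rewrite len_u len_v addrC => h h'.
by rewrite (bool_irrelevance h h').
Qed.

Lemma stable_mid x f y : stable_word = x * f * y -> n < zsize (wlen x) ->
  n < zsize (wlen y) -> zsize (wlen f) <= n -> exists j, factor f (w ^+ j).
Proof.
move=> e nx ny nf.
have lx : (wlen x + wlen f + wlen y = 'X^D)%R by rewrite -!wlenM -e.
have ef := wseg_factor e; rewrite add0r in ef.
have w0 : (0 < wlen w)%R by apply: lt_le_trans (wlen_pos w_neq1); exact: ltr01.
have [i hi] : exists i : nat, (- low (wlen x) <= wlen w *+ i)%R.
  by apply: zarch => //; rewrite /zsize size_polyN; exact: zsize_low.
pose a := (low (wlen x) + wlen w *+ i)%R.
have a0 : (0 <= a)%R by rewrite /a addrC -lerBlDr sub0r.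
have na : zsize a <= n.
  by rewrite (leq_trans (size_polyD _ _)) // geq_max zsize_low zsizeMn.
have [j hj] : exists j : nat, (a + wlen f <= wlen w *+ j)%R.
  by apply: zarch => //; rewrite zsizeD ?wlen_ge0 // geq_max na nf.
exists j.
have hp : (0 <= wlen w *+ j)%R by rewrite mulrn_wge0 // ltW.
have [p [z [ez lp]]] : exists p z, w ^+ j = p * z /\ wlen p = a.
  apply: cut_word; rewrite a0 wlenX (le_trans _ hj) //.
  by rewrite lerDl wlen_ge0.
have [f' [q [eq lf']]] : exists f' q, z = f' * q /\ wlen f' = wlen f.
  apply: cut_word; rewrite wlen_ge0 /=.
  by rewrite -(lerD2l a) -{2}lp -wlenM -ez wlenX.
suff ff : f = f' by exists p, q; rewrite ez eq ff mulgA.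
have := @wseg_factor X (periodic d w) 0%R _ hp p f' q.
rewrite -pow_seg ez eq mulgA => /(_ erefl) ->.
rewrite ef lp add0r; apply: word_ext => /= [|b h1 h2]; first by rewrite lf'.
have nb : zsize b <= n by apply: leq_trans nf; apply: zsize_segment.
rewrite /stable_letter lowD (low_id nb) addrA !(inj_eq (addIr b)).
have -> : (wlen x == low (wlen x))%R = false.
  by apply/eqP => e'; move: nx; rewrite e' ltnNge zsize_low.
have -> : (wlen x == 'X^D + low (wlen x))%R = false.
  apply/eqP => e'; move: ny; rewrite ltnNge => /negP; apply.
  have -> : wlen y = (- (low (wlen x) + wlen f))%R.
    by move: lx; rewrite {1}e' -!addrA -[RHS]addr0 => /addrI/eqP;
       rewrite addrA addrC addr_eq0 => /eqP.
  rewrite /zsize size_polyN (leq_trans (size_polyD _ _)) // geq_max.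
  by rewrite zsize_low nf.
by rewrite /a addrAC periodicMn.
Qed.

End StableWord.

Section Stable.
Variables (G : groupType) (Sigma : set G) (D : nat).
Notation L := (letter Sigma).
Notation W := (word L).
Implicit Types (x y z p q u v w s f c : W).

(** The properties of the word of the stable letter that the argument uses:
    it has period [u] from the left and [v] from the right, and away from both
    ends it looks locally like powers of [w]. In this form they are symmetric
    under [bar], see [stable_bar]. *)
Record stable u v w s : Prop := Stable {
  stable_len : wlen s = ('X^D)%R;
  stable_lenl : wlen u = wlen w;
  stable_lenr : wlen v = wlen w;
  stable_lt : zsize (wlen w) < D;
  stable_prim : primitive w;
  stable_period : u * s = s * v;
  stable_middle : forall x f y, s = x * f * y ->
    zsize (wlen w) < zsize (wlen x) -> zsize (wlen w) < zsize (wlen y) ->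
    zsize (wlen f) <= zsize (wlen w) -> exists j, factor f (w ^+ j);
  stable_reduced : G_reduced s
}.

Lemma factor_bar x y : factor x y -> factor (bar x) (bar y).
Proof.
by move=> [p [q ->]]; exists (bar q), (bar p); rewrite !barM mulgA.
Qed.

Lemma bar_exp x n : bar (x ^+ n) = bar x ^+ n.
Proof.
by elim: n => [|n ih]; rewrite ?expg0 ?bar1 // expgS barM ih -expgSr.
Qed.

Lemma bar_neq1 x : x <> 1 -> bar x <> 1.
Proof. by move=> x1 e; apply: x1; rewrite -[x]barK e bar1. Qed.

Lemma primitive_bar w : primitive w -> primitive (bar w).
Proof.
move=> [w1 wpre wbar]; split; first exact: bar_neq1.
  move=> p q /(congr1 (@bar G Sigma)); rewrite !barM !barK mulgA => /wpre.
  by move=> [e|e]; [right|left]; rewrite -[LHS]barK e bar1.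
by move=> /factor_bar; rewrite barK barM !barK => h; apply: wbar.
Qed.

Lemma stable_bar u v w s : stable u v w s -> stable (bar v) (bar u) (bar w) (bar s).
Proof.
case=> h1 h2 h3 h4 h5 h6 h7 h8; split=> //; first exact: primitive_bar.
- by rewrite -!barM h6.
- move=> x f y e nx ny nf.
  have := h7 (bar y) (bar f) (bar x); rewrite !wlen_bar.
  case=> //; first by rewrite -[s]barK e !barM mulgA.
  by move=> j /factor_bar; rewrite barK bar_exp; exists j.
- exact: G_reduced_bar.
Qed.

Lemma conj_exp u v s : u * s = s * v -> forall k, u ^+ k * s = s * v ^+ k.
Proof.
move=> h; elim=> [|k ih]; first by rewrite !expg0 mul1g mulg1.
by rewrite expgSr -mulgA h mulgA ih -mulgA -expgSr.
Qed.

Lemma mulw_levir x y x' y' : x * y = x' * y' -> (wlen y <= wlen y')%R ->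
  exists2 z, y' = z * y & x = x' * z.
Proof.
move=> e le; have le' : (wlen x' <= wlen x)%R.
  by have := congr1 (@wlen _) e; rewrite !wlenM => h; lra.
by have [z ex ey] := levi (esym e) le'; exists z.
Qed.

Lemma reduced_of_cyclically u : cyclically_G_reduced u -> G_reduced u.
Proof. by move=> /(_ 1%N); rewrite expg1. Qed.

(** The word is reduced because a finite factor lies within one class, and
    therefore in a power of [u], [v] or [w]. *)
Lemma stable_exists u v w : primitive w ->
  wlen u = wlen w -> wlen v = wlen w -> zsize (wlen w) < D ->
  cyclically_G_reduced u -> cyclically_G_reduced v -> cyclically_G_reduced w ->
  exists s, stable u v w s.
Proof.
move=> pw lu lv wD ru rv rw; have [w1 _ _] := pw.
have [d _] := first_letter w1.
exists (stable_word d D u v w).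
have sconj := @stable_conj _ d D u v w lu lv wD.
have smid := @stable_mid _ d D u v w w1.
have w0 : (0 < wlen w)%R by apply: lt_le_trans (wlen_pos w1); exact: ltr01.
split=> // l l0 [x [y es]].
set f := finite_word l in es; set s := stable_word _ _ _ _ _ in es sconj smid.
have nf : zsize (wlen f) <= zsize (wlen w).
  apply: (@leq_trans 1%N).
    rewrite /f wlen_finite -[(size l)%:R%R]/(1 *+ size l)%R.
    by apply: leq_trans (zsizeMn _ _) _; rewrite /zsize size_poly1.
  by rewrite lt0n size_poly_eq0; apply/eqP => e; rewrite e ltxx in w0.
have [nx|nx] := leqP (zsize (wlen x)) (zsize (wlen w)).
  have [k hk] : exists k : nat, (wlen x + wlen f <= wlen w *+ k)%R.
    by apply: zarch => //; rewrite zsizeD ?wlen_ge0 // geq_max nx.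
  apply: (ru k l l0).
  have : (x * f) * (y * v ^+ k) = u ^+ k * s.
    by rewrite (conj_exp sconj) es !mulgA.
  move=> /levi [|z -> _]; first by rewrite wlenM wlenX lu.
  by exists x, z.
have [ny|ny] := leqP (zsize (wlen y)) (zsize (wlen w)).
  have [k hk] : exists k : nat, (wlen f + wlen y <= wlen w *+ k)%R.
    by apply: zarch => //; rewrite zsizeD ?wlen_ge0 // geq_max ny nf.
  apply: (rv k l l0).
  have : (u ^+ k * x) * (f * y) = s * v ^+ k.
    by rewrite -(conj_exp sconj) es !mulgA.
  move=> /mulw_levir [|z -> _]; first by rewrite wlenM wlenX lv.
  by exists z, y; rewrite mulgA.
have [j fj] := smid _ _ _ es nx ny nf.
exact: rw j l l0 fj.
Qed.

Section Analysis.
Variables (u v w s : W).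
Hypothesis st : stable u v w s.

Lemma small_lt x y : small D x -> ~~ small D y -> (wlen x <= wlen y)%R.
Proof.
rewrite /small -ltnNge => sx sy; apply: lt_zsize; last exact: wlen_ge0.
exact: leq_ltn_trans sx sy.
Qed.

(** Behind an initial segment of degree just above that of [w], the word is far
    from both ends. *)
Lemma stable_contains a f b k : s = a * f * b -> small D a -> small D b ->
  ~~ small D f -> exists q q', [/\ f = q * w ^+ k * q',
    zsize (wlen w) < zsize (wlen q) & ~~ small D q'].
Proof.
move=> es sa sb bf.
have w0 : (0 < wlen w)%R.
  have [w1 _ _] := stable_prim st.
  by apply: lt_le_trans (wlen_pos w1); exact: ltr01.
have lw := stable_lt st.
have lX : (0 <= 'X^(zsize (wlen w)) :> Zt)%R by rewrite ltW ?zXn_gt0.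
have lk : (0 <= wlen w *+ k.+1)%R by rewrite mulrn_wge0 // wlen_ge0.
have nk : zsize (wlen w *+ k.+1)%R <= zsize (wlen w) := zsizeMn _ _.
have [q [t [ef lq]]] : exists q t, f = q * t /\ wlen q = ('X^(zsize (wlen w)))%R.
  apply: cut_word; rewrite lX; apply: lt_zsize; last exact: wlen_ge0.
  by rewrite /zsize size_polyXn -/(zsize (wlen w)) (leq_ltn_trans lw) // ltnNge.
have sq : small D q by rewrite /small lq zsize_Xn.
have bt : ~~ small D t by move: bf; rewrite ef smallM sq.
have [t1 [q' [et lt1]]] : exists t1 q', t = t1 * q' /\ wlen t1 = (wlen w *+ k.+1)%R.
  apply: cut_word; rewrite lk; apply: lt_zsize; last exact: wlen_ge0.
  by rewrite (leq_ltn_trans nk) // (ltn_trans lw) // ltnNge.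
have st1 : small D t1 by rewrite /small lt1 (leq_trans nk) // ltnW.
have bq' : ~~ small D q' by move: bt; rewrite et smallM st1.
have wq : zsize (wlen w) < zsize (wlen q) by rewrite lq zsize_Xn.
have [||||j fj] := @stable_middle _ _ _ _ st (a * q) t1 (q' * b).
- by rewrite es ef et !mulgA.
- by rewrite wlenM zsizeD ?wlen_ge0 // leq_max wq orbT.
- rewrite wlenM zsizeD ?wlen_ge0 // leq_max; apply/orP; left.
  by rewrite (ltn_trans lw) // ltnNge.
- by rewrite lt1.
have [r [r' et1]] := factor_pow_contains fj lt1.
exists (q * r), (r' * q'); split.
- by rewrite ef et et1 !mulgA.
- by rewrite wlenM zsizeD ?wlen_ge0 // leq_max wq.
- by rewrite smallM (negbTE bq') andbF.
Qed.

(** The factor [f] contains a copy of [w] far inside. Its mirror image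
    [bar w] sits far inside the second occurrence, hence in a power of [w],
    against the second condition of primitivity. *)
Lemma stable_no_inverse a f b b' a' : s = a * f * b -> s = b' * bar f * a' ->
  small D a -> small D b -> small D a' -> small D b' -> ~~ small D f -> False.
Proof.
move=> e1 e2 sa sb sa' sb' bf.
have [q [q' [ef wq bq']]] := stable_contains 1%N e1 sa sb bf.
have [_ _ wbar] := stable_prim st; apply: wbar.
have lw := stable_lt st.
have [||||j fj] := @stable_middle _ _ _ _ st (b' * bar q') (bar w) (bar q * a').
- by rewrite e2 ef expg1 !barM !mulgA.
- rewrite wlenM zsizeD ?wlen_ge0 // leq_max; apply/orP; right.
  by rewrite wlen_bar (ltn_trans lw) // ltnNge.
- by rewrite wlenM zsizeD ?wlen_ge0 // leq_max wlen_bar wq.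
- by rewrite wlen_bar.
exact: factor_pow_square fj _.
Qed.

End Analysis.
End Stable.

(** * Two occurrences of a long factor *)

Section GivenBy.
Variables (G : groupType) (Sigma : set G).
Notation L := (letter Sigma).
Notation W := (word L).
Notation E := (E_group Sigma).
Implicit Types (x y p q : W) (a b : E).

Lemma given_by_inj a b p : given_by a p -> given_by b p -> a = b.
Proof. by move=> ea eb; apply: val_inj; rewrite ea eb. Qed.

Lemma given_by1 : given_by (1 : E) 1.
Proof. by []. Qed.

Lemma given_byM a b p q : given_by a p -> given_by b q -> given_by (a * b) (p * q).
Proof.
rewrite /given_by M_classM => <- <-; exact: gmulfM.
Qed.

Lemma given_byX a p n : given_by a p -> given_by (a ^+ n) (p ^+ n).
Proof.
move=> h; elim: n => [|n ih]; first by rewrite !expg0; exact: given_by1.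
by rewrite !expgS; apply: given_byM.
Qed.

Lemma given_by_value a p : given_by a p -> a = 1 <-> value p 1.
Proof.
move=> ap; split=> [a1|/value_M_class e].
  have : M_class p = M_class 1 by rewrite -ap a1.
  by move=> /(M_class_value 1) ->; exact: value_one.
by apply: val_inj; rewrite ap e.
Qed.

Lemma given_by_ex p : G_reduced p -> exists a, given_by a p.
Proof.
move=> hp.
have h : M_class p \in @E_set G Sigma.
  apply/mem_set; exists p => //; exists [:: p]; last by rewrite big_seq1.
  by move=> q; rewrite inE => /eqP ->.
by exists (Sub (M_class p) h); rewrite /given_by SubK.
Qed.

Lemma given_byV a p : G_reduced p -> given_by a p -> given_by a^-1 (bar p).
Proof.
move=> hp ap; have [b bp] := given_by_ex (G_reduced_bar hp).
suff -> : a^-1 = b by [].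
apply: mulg1_eq; apply/(given_by_value (given_byM ap bp)).
by have := value_conj hp (value_one Sigma); rewrite mulg1.
Qed.

End GivenBy.

Section Shift.
Variables (G : groupType) (Sigma : set G) (D : nat).
Notation L := (letter Sigma).
Notation W := (word L).
Notation E := (E_group Sigma).
Variables (u v w s : W).
Hypothesis st : stable D u v w s.
Implicit Types (x y z p q f c : W).

Lemma smallX x n : small D x -> small D (x ^+ n).
Proof.
by move=> sx; elim: n => [|n ih]; rewrite ?expg0 ?small1 // expgS smallM sx.
Qed.

Lemma prefix_eq f x y x' y' : f = x * y -> f = x' * y' -> wlen x = wlen x' -> x = x'.
Proof. by move=> -> e l; have [] := mulw_inj e l. Qed.

(** The first equation says that [f] coincides with itself moved by [x], so
    prefixes of [f] may be multiplied by [x]. *)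
Lemma prefix_shift x y f f1 b b' : x * f * b = f * b' -> f = y * f1 ->
  small D x -> small D y -> ~~ small D f -> exists f2, f = x * y * f2.
Proof.
move=> e ef sx sy bf; have sxy : small D (x * y) by rewrite smallM sx.
have : (x * y) * (f1 * b) = f * b' by rewrite -e ef !mulgA.
by move=> /levi [|f2 ef2 _]; [apply: small_lt bf|exists f2].
Qed.

(** The word [f] overlaps itself with shift [c], and it contains a power of [w]
    that is longer than this shift. So [w * w] overlaps a shifted copy of
    itself, and by the first condition of primitivity the shift is a multiple
    of [wlen w]. *)
Lemma stable_shift_length p f a p' a' c :
  s = p * f * a -> f * a' = c * f * a -> small D p -> small D a ->
  ~~ small D f -> zsize (wlen c) <= zsize (wlen w) ->
  exists i : nat, wlen c = (wlen w *+ i)%R.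
Proof.
move=> e ec sp sa bf nc.
have [w1 wpre _] := stable_prim st.
have w0 : (0 < wlen w)%R by apply: lt_le_trans (wlen_pos w1); exact: ltr01.
have [k lk] := zarch w0 nc.
have [q [q' [ef _ _]]] := stable_contains st k.+2 e sp sa bf.
(* c1 is the shift c as read at the place of the power of w *)
have [c1 ecq ew] : exists2 c1, c * q = q * c1 &
    w ^+ k.+2 * q' * a' = c1 * (w ^+ k.+2 * q' * a).
  have : q * (w ^+ k.+2 * q' * a') = (c * q) * (w ^+ k.+2 * q' * a).
    by move: ec; rewrite ef !mulgA.
  move=> /levi [|c1 ? ?]; first by rewrite wlenM lerDr wlen_ge0.
  by exists c1.
have lc : wlen c1 = wlen c := esym (wlen_conj ecq).
case: k lk ef ew => [|k] lk ef ew.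
  exists 0%N; rewrite mulr0n in lk *; apply/eqP; rewrite eq_le lk.
  exact: wlen_ge0.
have ewk : w ^+ k.+3 = w ^+ k.+1 * (w * w).
  by rewrite -[k.+3]/(2 + k.+1)%N addnC expgnDr expg2.
have [y ec1 ey] : exists2 y, w ^+ k.+1 = c1 * y &
    w ^+ k.+3 * q' * a = y * (w * w * q' * a').
  have : c1 * (w ^+ k.+3 * q' * a) = w ^+ k.+1 * (w * w * q' * a').
    by rewrite -ew ewk !mulgA.
  by move=> /levi [|y h1 h2]; [rewrite lc wlenX|exists y].
have [i [r [r' [m [ec1' er er']]]]] := pow_cut ec1.
have : w * w * (w ^+ k.+1 * q' * a) = r' * w * (w ^+ m * w * q' * a').
  have -> : w * w * (w ^+ k.+1 * q' * a) = w ^+ k.+3 * q' * a.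
    by rewrite !expgS !mulgA.
  rewrite ey er' -!mulgA; congr (_ * _); rewrite !mulgA; congr (_ * _ * _ * _).
  by rewrite -expgS -expgSr.
move=> /esym/levi [|t et _].
  by rewrite !wlenM lerD2r er wlenM lerDr wlen_ge0.
case: (wpre r' t (esym et)) => e1.
  exists i.+1; rewrite -lc ec1' wlenM wlenX mulrSr; congr (_ + _)%R.
  by rewrite er e1 mulg1.
exists i; suff r1 : r = 1 by rewrite -lc ec1' r1 mulg1 wlenX.
apply: wlen_eq0; have := congr1 (@wlen L) et; rewrite e1 mulg1 {1}er !wlenM.
by move=> /addIr; rewrite -[RHS]add0r => /addIr.
Qed.

(** Let [f] occur in [s] behind [p] and behind the shorter [p'], and let [c] be
    the shift. Since [s] has period [u], the prefix [z] of [f] of the length of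
    [u] is the conjugate of [u] by both [p] and [p']. Moreover [f] is so long that
    all products of powers of [c] and [z] are prefixes of it. Prefixes of the
    same length are equal, which gives both the commutation of [c] with [z] and
    the last claim. *)
Lemma stable_shift p f a p' a' : s = p * f * a -> s = p' * f * a' ->
  small D p -> small D a -> small D p' -> small D a' -> ~~ small D f ->
  (wlen p' <= wlen p)%R ->
  exists c z, [/\ p = p' * c, u * p' = p' * z, c * z = z * c,
    (forall i k, exists y, f = c ^+ i * z ^+ k * y) &
    (forall n m : nat, 0 < n -> (wlen c *+ n = wlen u *+ m)%R ->
      exists i, c = z ^+ i)].
Proof.
move=> e e' sp sa sp' sa' bf le.
have lw := stable_lt st.
have su : small D u by rewrite /small (stable_lenl st) ltnW.
have [c ep ec] : exists2 c, p = p' * c & f * a' = c * f * a.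
  have := e'; rewrite e -!mulgA => /esym/levi [|c -> ->] //.
  by exists c; rewrite ?mulgA.
have per q b : s = q * f * b -> exists z, [/\ u * q = q * z, wlen z = wlen u &
    z * f * b = f * (b * v)].
  move=> es; have : q * (f * (b * v)) = (u * q) * (f * b).
    by have := stable_period st; rewrite es !mulgA => ->.
  move=> /levi [|z ez ez']; first by rewrite wlenM lerDr wlen_ge0.
  by exists z; split; [|exact: esym (wlen_conj ez)|rewrite ez' mulgA].
have [z [uz lz zf]] := per _ _ e.
have [z' [uz' lz' zf']] := per _ _ e'.
have sz : small D z by rewrite /small lz.
have sc : small D c by move: sp; rewrite ep smallM => /andP[].
have zz : z = z'.
  have [f1 ef1] := @prefix_shift z 1 f f a (a * v) zf (esym (mul1g _)) sz (small1 _ _) bf.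
  have [f2 ef2] := @prefix_shift z' 1 f f a' (a' * v) zf' (esym (mul1g _))
    (etrans (congr1 (fun t => zsize t <= D) lz') su) (small1 _ _) bf.
  rewrite !mulg1 in ef1 ef2.
  by apply: (prefix_eq ef1 ef2); rewrite lz lz'.
subst z'.
have pre i k : exists y, f = c ^+ i * z ^+ k * y.
  elim: i => [|i [y ih]].
    elim: k => [|k [y ih]]; first by exists f; rewrite !expg0 !mul1g.
    rewrite expg0 mul1g in ih.
    have [f2 ->] := prefix_shift zf ih sz (smallX k sz) bf.
    by exists f2; rewrite expg0 mul1g expgS.
  have sci : small D (c ^+ i * z ^+ k) by rewrite smallM !smallX.
  have [f2 ->] := prefix_shift (esym ec) ih sc sci bf.
  by exists f2; rewrite expgS !mulgA.
exists c, z; split=> //.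
  apply: (@mulwI _ p'); rewrite /= !mulgA -ep -uz' -(mulgA u) -ep.
  by rewrite uz.
move=> n m n0 enm.
have lc : zsize (wlen c) <= zsize (wlen w).
  rewrite -(stable_lenl st); apply: leq_trans (zsizeMn (wlen u) m).
  rewrite -enm; apply: zsize_le (wlen_ge0 _) _.
  by rewrite -[X in (X <= _)%R]mulr1n; apply: ler_wpMn2l => //; apply: wlen_ge0.
have [i ei] := @stable_shift_length p f a p' a' c e ec sp sa bf lc.
exists i; have [y ey] := pre 1%N 0%N; have [y' ey'] := pre 0%N i.
rewrite expg1 expg0 mulg1 in ey; rewrite expg0 mul1g in ey'.
by apply: (prefix_eq ey ey'); rewrite wlenX lz (stable_lenl st).
Qed.

(** Conjugation by [p'] turns [h] into [c] and [U] into [z]. As [c] and [z]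
    commute, [h] centralizes [U], so a power of [h] is a power of [U]. The
    corresponding powers of [c] and [z] are prefixes of the reduced word [f],
    hence equal as words, and comparing lengths shows that the shift has at
    most the degree of [w]. Then [stable_shift] makes [c] a power of [z]. *)
Lemma shift_power (h U p0 p0' : E) p f a p' a' :
  s = p * f * a -> s = p' * f * a' ->
  small D p -> small D a -> small D p' -> small D a' -> ~~ small D f ->
  (wlen p' <= wlen p)%R ->
  given_by U u -> given_by p0 p -> given_by p0' p' -> h * p0' = p0 ->
  (h * U = U * h -> exists n m : nat, 0 < n /\ (h ^+ n = U ^+ m \/ h ^+ n * U ^+ m = 1)) ->
  exists i, h = U ^+ i.
Proof.
move=> e e' sp sa sp' sa' bf le gU gp gp' hp hU.
have [c [z [ep uz cz pre powers]]] := stable_shift e e' sp sa sp' sa' bf le.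
have rf : G_reduced f.
  by have := stable_reduced st; rewrite e => /reducedL/reducedR.
have rpre x y : f = x * y -> G_reduced x by move: rf => /[swap] -> /reducedL.
have [yc eyc] := pre 1%N 0%N; have [yz eyz] := pre 0%N 1%N.
rewrite expg1 expg0 mulg1 in eyc; rewrite expg1 expg0 mul1g in eyz.
have [c0 gc] := given_by_ex (rpre _ _ eyc).
have [z0 gz] := given_by_ex (rpre _ _ eyz).
have hc : h * p0' = p0' * c0.
  by rewrite hp; apply: given_by_inj gp _; rewrite ep; apply: given_byM.
have Uz : U * p0' = p0' * z0.
  apply: given_by_inj (given_byM gU gp') _; rewrite uz; exact: given_byM.
have czE : c0 * z0 = z0 * c0.
  apply: given_by_inj (given_byM gc gz) _; rewrite cz; exact: given_byM.
have conj (x y : E) : x * p0' = p0' * y -> forall n, x ^+ n * p0' = p0' * y ^+ n.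
  move=> xy; elim=> [|n ih]; first by rewrite !expg0 mul1g mulg1.
  by rewrite expgSr -mulgA xy mulgA ih -mulgA -expgSr.
have hUc : h * U = U * h.
  apply: (@mulIg _ p0'); rewrite /= -!mulgA Uz hc (mulgA h) hc (mulgA U) Uz.
  by rewrite -!mulgA czE.
have [n [m [n0 hnm]]] := hU hUc.
have [i ci] : exists i, c = z ^+ i; last first.
  exists i; apply: (@mulIg _ p0'); rewrite /= hc (conj _ _ Uz); congr (_ * _).
  by apply: given_by_inj gc _; rewrite ci; apply: given_byX.
case: hnm => hnm.
  have ecz : c0 ^+ n = z0 ^+ m.
    by apply: (@mulgI _ p0'); rewrite /= -(conj _ _ hc) hnm (conj _ _ Uz).
  apply: (powers n m n0).
  have [y ey] := pre n 0%N; have [y' ey'] := pre 0%N m.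
  rewrite expg0 mulg1 in ey; rewrite expg0 mul1g in ey'.
  have trivial (x1 x2 t f1 : W) (a1 a2 : E) : given_by a1 x1 -> given_by a2 x2 ->
      a1 = a2 -> x2 = x1 * t -> f = x2 * f1 -> x1 = x2.
    move=> g1 g2 e12 ex ef.
    have rt : G_reduced t by move: (rpre _ _ ef); rewrite ex => /reducedR.
    have [t0 gt] := given_by_ex rt.
    have t1 : t0 = 1.
      apply: (@mulgI _ a1); rewrite mulg1 e12.
      by apply: given_by_inj g2; rewrite ex -e12; apply: given_byM.
    have := value_reduced1 (iffLR (given_by_value gt) t1) rt.
    by move=> te; rewrite ex te mulg1.
  have gcn := given_byX n gc; have gzm := given_byX m gz.
  have lz : wlen z = wlen u := esym (wlen_conj uz).
  rewrite -lz -!wlenX; congr wlen.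
  have := ey; rewrite ey' => /leviP [[t et _]|[t et _]]; last first.
    exact: trivial gcn gzm ecz et ey'.
  by symmetry; apply: trivial gzm gcn (esym ecz) et ey.
have [y ey] := pre n m.
have e1 : c0 ^+ n * z0 ^+ m = 1.
  apply: (@mulgI _ p0'); rewrite mulgA -(conj _ _ hc) -mulgA -(conj _ _ Uz).
  by rewrite mulgA hnm mul1g mulg1.
have g1 : given_by (c0 ^+ n * z0 ^+ m) (c ^+ n * z ^+ m).
  by apply: given_byM; apply: given_byX.
have cz1 := value_reduced1 (iffLR (given_by_value g1) e1) (rpre _ _ ey).
have [cn1 _] := mulw_eq1 cz1.
apply: (powers n 0%N n0).
by rewrite -wlenX cn1 mulr0n.
Qed.

Lemma pinch_power (h U : E) x p f a p' a' :
  given_by U u -> given_by h x ->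
  s = p * f * a -> s = p' * f * a' ->
  small D p -> small D a -> small D p' -> small D a' -> ~~ small D f ->
  value (bar p * x * p') 1 ->
  (h * U = U * h -> exists n m : nat, 0 < n /\ (h ^+ n = U ^+ m \/ h ^+ n * U ^+ m = 1)) ->
  exists i, h = U ^+ i \/ h = (U ^+ i)^-1.
Proof.
move=> gU gh e e' sp sa sp' sa' bf hv hU.
have red q y : s = q * y -> G_reduced q.
  by move=> es; have := stable_reduced st; rewrite es => /reducedL.
have rp : G_reduced p by apply: (@red p (f * a)); rewrite mulgA.
have rp' : G_reduced p' by apply: (@red p' (f * a')); rewrite mulgA.
have [p0 gp] := given_by_ex rp; have [p0' gp'] := given_by_ex rp'.
have hp : h * p0' = p0.
  apply: (@mulgI _ p0^-1); rewrite mulVg mulgA.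
  by apply/(given_by_value (given_byM (given_byM (given_byV rp gp) gh) gp')).
have [le|/ltW le] := leP (wlen p') (wlen p).
  have [i ei] := shift_power e e' sp sa sp' sa' bf le gU gp gp' hp hU.
  by exists i; left.
have hp' : h^-1 * p0 = p0' by rewrite -hp mulKg.
have [|i ei] := shift_power e' e sp' sa' sp sa bf le gU gp' gp hp'; last first.
  by exists i; right; rewrite -ei invgK.
move=> hUc.
have [|n [m [n0 hnm]]] := hU.
  by apply: (@mulgI _ h^-1); rewrite /= mulKg mulgA hUc mulgVK.
exists n, m; split=> //; rewrite expVgn.
by case: hnm => hnm; [right; rewrite hnm mulVg|left; apply: mulg1_eq].
Qed.

End Shift.

(** * Cyclic subgroups and HNN extensions *)

Section CyclicSubgroups.
Variables (K : groupType).
Implicit Types (c x y h u : K).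

(** Quotients of powers with natural exponents, which are closed under products
    without a case distinction on signs. *)
Definition power_of c : {pred K} := fun x => `[< exists n m, x = c ^+ n / c ^+ m >].

Lemma power_ofP c x : reflect (exists n m, x = c ^+ n / c ^+ m) (x \in power_of c).
Proof. exact: asboolP. Qed.

Lemma power_of_mul c : mulg_closed (power_of c).
Proof.
move=> x y /power_ofP [n [m ->]] /power_ofP [n' [m' ->]].
apply/power_ofP; exists (n + n')%N, (m' + m)%N.
have cm : (c ^+ m)^-1 * c ^+ n' = c ^+ n' / c ^+ m.
  by symmetry; apply/commuteV/commuteX2; exact: commute_refl.
by rewrite !expgnDr invgM !mulgA -(mulgA (c ^+ n)) cm !mulgA.
Qed.

Lemma power_of1 c : 1 \in power_of c.
Proof. by apply/power_ofP; exists 0%N, 0%N; rewrite expg0 divg1. Qed.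

Lemma power_ofV c : invg_closed (power_of c).
Proof.
by move=> x /power_ofP [n [m ->]]; apply/power_ofP; exists m, n; rewrite invgF.
Qed.

HB.instance Definition _ c := isMulClosed.Build K (power_of c) (@power_of_mul c).
HB.instance Definition _ c := isMul1Closed.Build K (power_of c) (@power_of1 c).
HB.instance Definition _ c := isInvClosed.Build K (power_of c) (@power_ofV c).

Lemma generated_power c x : generated [set c] x ->
  exists n, x = c ^+ n \/ x = (c ^+ n)^-1.
Proof.
move=> H; have /power_ofP [n [m ->]] : x \in power_of c.
  by apply: H => y ->; apply/power_ofP; exists 1%N, 0%N; rewrite expg1 expg0 divg1.
have [mn|/ltnW nm] := leqP m n.
  by exists (n - m)%N; left; rewrite expgnFr.
by exists (m - n)%N; right; rewrite expgnFr // invgF.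
Qed.

Lemma commensurable c h u : generated [set c] h -> generated [set c] u -> u <> 1 ->
  exists n m, 0 < n /\ (h ^+ n = u ^+ m \/ h ^+ n * u ^+ m = 1).
Proof.
move=> /generated_power [a ha] /generated_power [b ub] u1; exists b, a.
split; first by case: b ub => // -[] e; case: u1; rewrite e ?expg0 ?invg1.
by case: ha => ->; case: ub => ->; rewrite ?expVgn (expgnAC c b a);
   [left|right|right|left]; rewrite ?mulgV ?mulVg.
Qed.

End CyclicSubgroups.

Lemma embeds_intro (K L : groupType) (f : K -> L) : {morph f : x y / x * y} ->
  (forall x, f x = 1 -> x = 1) -> embeds_into K L.
Proof.
move=> fM f1; pose m := isMultiplicative.Build K L f fM.
pose F : {multiplicative K -> L} := HB.pack f m.
exists F => x y /= exy; apply: divg1_eq; apply: f1.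
by rewrite fM exy -fM mulgV; apply: (@mulgI _ (f 1)); rewrite /= -fM !mulg1.
Qed.

Section HNNMorphism.
Variables (K L : groupType) (u v : K) (phi : K -> L) (t : L).
Hypothesis phiM : {morph phi : x y / x * y}.
Hypothesis phi_conj : t^-1 * phi u * t = phi v.

Definition hnn_letter_map (c : hnn_letter K) : L :=
  match c with HnnBase k => phi k | HnnStable => t | HnnStableInv => t^-1 end.

Definition hnn_word_map (l : hnn_word K) : L := \prod_(c <- l) hnn_letter_map c.

Lemma hnn_word_mapM l l' : hnn_word_map (l * l') = hnn_word_map l * hnn_word_map l'.
Proof. exact: big_cat. Qed.

Lemma hnn_word_map_cong l l' : cong (hnn_rel u v) l l' ->
  hnn_word_map l = hnn_word_map l'.
Proof.
elim=> {l l'} [x y r|//|x y _ -> //|x y z _ -> _ -> //|x x' y y' _ e1 _ e2].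
  have phi1 : phi 1 = 1 by apply: (@mulgI _ (phi 1)); rewrite /= -phiM !mulg1.
  rewrite /hnn_word_map; case: {x y} r => [|h k|||]; rewrite ?big_cons ?big_nil /=.
  - by rewrite phi1 mulg1.
  - by rewrite phiM !mulg1.
  - by rewrite mulg1 mulgV.
  - by rewrite mulg1 mulVg.
  - by rewrite !mulg1 -phi_conj mulgA.
by rewrite !hnn_word_mapM e1 e2.
Qed.

Definition hnn_map (a : HNN u v) : L := hnn_word_map (sval (cid (class_of_surj a))).

Lemma hnn_mapE l : hnn_map (class_of (hnn_rel u v) l) = hnn_word_map l.
Proof.
apply: hnn_word_map_cong; apply/class_ofP.
by case: cid => l' /= <-.
Qed.

Lemma hnn_map_is_multiplicative : {morph hnn_map : x y / x * y}.
Proof.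
move=> a b; have [x ->] := class_of_surj a; have [y ->] := class_of_surj b.
have -> : (class_of (hnn_rel u v) x : HNN u v) * class_of (hnn_rel u v) y =
  class_of (hnn_rel u v) (x * y) by rewrite class_ofM.
by rewrite !hnn_mapE hnn_word_mapM.
Qed.

Definition base (k : K) : HNN u v := class_of (hnn_rel u v) [:: HnnBase k].

Definition stable_power (e : bool) : HNN u v :=
  class_of (hnn_rel u v) [:: if e then HnnStable K else HnnStableInv K].

Lemma baseM h k : base (h * k) = base h * base k.
Proof.
rewrite /base -class_ofM; symmetry; apply/class_ofP; apply: cong_rel.
exact: hnn_mul.
Qed.

Lemma base1 : base 1 = 1.
Proof. by apply/class_ofP; apply: cong_rel; exact: hnn_one. Qed.

Lemma baseV k : base k^-1 = (base k)^-1.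
Proof. by symmetry; apply: mulg1_eq; rewrite -baseM mulgV base1. Qed.

Lemma stable_powerV : (stable_power true)^-1 = stable_power false.
Proof.
apply: mulg1_eq; rewrite /stable_power -class_ofM; apply/class_ofP.
by apply: cong_rel; exact: hnn_stableV.
Qed.

Lemma base_conj : stable_power false * base u * stable_power true = base v.
Proof.
have cM (x y z : hnn_word K) : (class_of (hnn_rel u v) x : HNN u v) *
    class_of (hnn_rel u v) y * class_of (hnn_rel u v) z =
    class_of (hnn_rel u v) (x * y * z) by rewrite !class_ofM.
rewrite /stable_power /base cM; apply/class_ofP.
apply: cong_rel; exact (@hnn_conj K u v).
Qed.

(** The element of the HNN extension with the same syllables as the word
    [spell]. *)
Fixpoint hnn_form (k : K) (s : seq (bool * K)) : HNN u v :=
  match s with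
  | [::] => base k
  | (e, k') :: s' => base k * stable_power e * hnn_form k' s'
  end.

Lemma hnn_form_basel k k' s : base k * hnn_form k' s = hnn_form (k * k') s.
Proof. by case: s => [|[e k''] s] /=; rewrite baseM ?mulgA. Qed.

Lemma hnn_form_mul k s k' s' : exists k'' s'',
  hnn_form k s * hnn_form k' s' = hnn_form k'' s'' /\ size s'' = size s + size s'.
Proof.
elim: s k => [|[e h] s ih] k /=.
  by exists (k * k'), s'; rewrite hnn_form_basel.
have [k'' [s'' [e1 e2]]] := ih h.
by exists k, ((e, k'') :: s''); rewrite /= -mulgA e1 e2.
Qed.

Lemma hnn_form_cat k s1 e h s2 :
  hnn_form k (s1 ++ (e, h) :: s2) = hnn_form k s1 * stable_power e * hnn_form h s2.
Proof. by elim: s1 k => [|[e1 h1] s1 ih] k //=; rewrite ih !mulgA. Qed.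

Lemma hnn_form_surj (a : HNN u v) : exists k s, a = hnn_form k s.
Proof.
have [l ->] := class_of_surj a; elim: l => [|c l [k [s es]]].
  by exists 1, [::]; rewrite /= base1.
have -> : class_of (hnn_rel u v) (c :: l) =
  (class_of (hnn_rel u v) [:: c] : HNN u v) * class_of (hnn_rel u v) l.
  by rewrite -class_ofM.
rewrite es; case: c => [h||].
- by exists (h * k), s; rewrite hnn_form_basel.
- by exists 1, ((true, k) :: s); rewrite /= base1 mul1g.
- by exists 1, ((false, k) :: s); rewrite /= base1 mul1g.
Qed.

Lemma hnn_map_base k : hnn_map (base k) = phi k.
Proof. by rewrite hnn_mapE /hnn_word_map big_seq1. Qed.

Lemma hnn_map_stable e : hnn_map (stable_power e) = if e then t else t^-1.
Proof. by rewrite hnn_mapE /hnn_word_map big_seq1; case: e. Qed.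

End HNNMorphism.

(** * Short representatives of the elements of a finitely generated subgroup *)

Section SmallElements.
Variables (G : groupType) (Sigma : set G) (D : nat).
Notation W := (word (letter Sigma)).
Notation E := (E_group Sigma).
Implicit Types (a b : E) (x y : W).

Lemma R_starM x y : R_star x -> R_star y -> R_star (x * y).
Proof.
move=> [s hs ->] [r hr ->]; exists (s ++ r); last by rewrite big_cat.
by move=> p; rewrite mem_cat => /orP[/hs|/hr].
Qed.

Lemma R_star_bar x : R_star x -> R_star (bar x).
Proof.
move=> [s hs ->]; elim: s hs => [|p s ih] hs.
  by exists [::] => //; rewrite !big_nil bar1.
rewrite big_cons barM; apply: R_starM.
  by apply: ih => q qs; apply: hs; rewrite inE qs orbT.
exists [:: bar p]; last by rewrite big_seq1.
by move=> q; rewrite inE => /eqP ->; apply: G_reduced_bar; apply: hs; rewrite mem_head.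
Qed.

Lemma R_star_value x : R_star x -> value (x * bar x) 1.
Proof.
move=> [s hs ->]; elim: s hs => [|p s ih] hs.
  by rewrite big_nil bar1 mulg1; exact: value_one.
rewrite big_cons barM !mulgA -(mulgA p); apply: value_conj.
  by apply: hs; rewrite mem_head.
by apply: ih => q qs; apply: hs; rewrite inE qs orbT.
Qed.

Lemma R_star_given x : R_star x -> exists a, given_by a x.
Proof.
move=> hx; have h : M_class x \in @E_set G Sigma by apply/mem_set; exists x.
by exists (Sub (M_class x) h); rewrite /given_by SubK.
Qed.

Lemma given_R_star a : exists2 x, R_star x & given_by a x.
Proof.
by case: a => m hm; have [x rx ex] := set_mem hm; exists x; rewrite // /given_by /= ex.
Qed.

(** Words in [R_star] rather than arbitrary ones, as only the former can be
    inverted by [bar]. *)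
Definition small_element : {pred E} :=
  fun a => `[< exists x, [/\ R_star x, small D x & given_by a x] >].

Lemma small_elementP a :
  reflect (exists x, [/\ R_star x, small D x & given_by a x]) (a \in small_element).
Proof. exact: asboolP. Qed.

Lemma small_element_mul : mulg_closed small_element.
Proof.
move=> a b /small_elementP [x [rx sx ax]] /small_elementP [y [ry sy bY]].
apply/small_elementP; exists (x * y); split; first exact: R_starM.
  by rewrite smallM sx.
exact: given_byM.
Qed.

Lemma small_element1 : 1 \in small_element.
Proof.
apply/small_elementP; exists 1; split; rewrite ?small1 //.
by exists [::] => //; rewrite big_nil.
Qed.

Lemma small_elementV : invg_closed small_element.
Proof.
move=> a /small_elementP [x [rx sx ax]]; apply/small_elementP; exists (bar x).
split; rewrite ?small_bar //; first exact: R_star_bar.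
have [b bx] := R_star_given (R_star_bar rx).
suff -> : a^-1 = b by [].
by apply: mulg1_eq; apply/(given_by_value (given_byM ax bx)); apply: R_star_value.
Qed.

HB.instance Definition _ := isMulClosed.Build E small_element small_element_mul.
HB.instance Definition _ := isMul1Closed.Build E small_element small_element1.
HB.instance Definition _ := isInvClosed.Build E small_element small_elementV.

Lemma generated_small (S : set E) a : generated S a ->
  (forall b, S b -> b \in small_element) -> a \in small_element.
Proof. by move=> h hS; apply: (h small_element). Qed.

End SmallElements.

Lemma finitely_generated_small (G : groupType) (Sigma : set G)
    (H : groupClosed (E_group Sigma)) :
  finitely_generated H -> exists D0, forall D, D0 <= D ->
    forall a, a \in H -> a \in small_element D.
Proof.
move=> [s Hs].
have [D0 hD0] : exists D0, forall D, D0 <= D -> forall a, a \in s ->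
    a \in small_element D.
  elim: s {Hs} => [|b s [D0 ih]]; first by exists 0%N.
  have [x rx bx] := given_R_star b.
  exists (maxn (zsize (wlen x)) D0) => D; rewrite geq_max => /andP[xD D0D] a.
  rewrite inE => /orP[/eqP ->|]; last exact: ih.
  by apply/small_elementP; exists x.
exists D0 => D /hD0 h a aH; apply: (@generated_small _ _ _ [set` s]) => //.
by rewrite -Hs.
Qed.

(** * The embedding *)

Section Embedding.
Variables (G : groupType) (Sigma : set G) (D : nat).
Notation W := (word (letter Sigma)).
Notation E := (E_group Sigma).
Variables (H : groupClosed E) (u v : subgroup_type H).
Notation K := (subgroup_type H).
Variables (pu pv pw ps : W) (t : E) (wd : K -> W).
Hypotheses (D_gt0 : 0 < D) (st : stable D pu pv pw ps).
Hypotheses (gu : given_by (val u) pu) (gv : given_by (val v) pv).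
Hypotheses (gt : given_by t ps).
Hypotheses (rv : G_reduced pv).
Hypotheses (wd_small : forall k, small D (wd k)).
Hypotheses (wd_given : forall k : K, given_by (val k) (wd k)).
Hypotheses (u_rel : forall k : K, k * u = u * k ->
  exists n m, 0 < n /\ (k ^+ n = u ^+ m \/ k ^+ n * u ^+ m = 1)).
Hypotheses (v_rel : forall k : K, k * v = v * k ->
  exists n m, 0 < n /\ (k ^+ n = v ^+ m \/ k ^+ n * v ^+ m = 1)).
Implicit Types (k h : K).

Local Notation phi := (val : K -> E).

Definition stable_letter_word (e : bool) : W := if e then ps else bar ps.

Lemma conj_t : t^-1 * phi u * t = phi v.
Proof.
apply: (@mulgI _ t); rewrite /= !mulgA mulgV mul1g.
apply: given_by_inj (given_byM gu gt) _; rewrite (stable_period st).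
exact: given_byM.
Qed.

Lemma valK_M : {morph phi : x y / x * y}.
Proof. exact: valM. Qed.

Local Notation emb := (hnn_map phi t : HNN u v -> E).

Lemma embedding_form k s :
  given_by (emb (hnn_form u v k s)) (spell wd stable_letter_word k s).
Proof.
elim: s k => [|[e k'] s ih] k /=.
  by rewrite (hnn_map_base valK_M conj_t); apply: wd_given.
rewrite !(hnn_map_is_multiplicative valK_M conj_t).
apply: given_byM (ih k'); apply: given_byM.
  by rewrite (hnn_map_base valK_M conj_t); apply: wd_given.
rewrite (hnn_map_stable valK_M conj_t); case: e => //.
by apply: given_byV => //; apply: stable_reduced st.
Qed.

Lemma valK_X k n : phi (k ^+ n) = phi k ^+ n.
Proof.
elim: n => [|n ih]; last by rewrite !expgS valK_M ih.
by rewrite !expg0; apply: gmulf1.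
Qed.

Lemma valK_1 : phi 1 = 1.
Proof. by have := valK_X 1 0; rewrite !expg0. Qed.

Lemma valK_V k : phi k^-1 = (phi k)^-1.
Proof. by symmetry; apply: mulg1_eq; rewrite -valK_M mulgV valK_1. Qed.

Local Notation T := (stable_power u v).
Local Notation B := (base u v).

(** Equal signs are excluded by [stable_no_inverse]. For the inverse stable
    letter on the left, [pinch_power] makes [h] a power of [u]; for the opposite
    order it makes [h] a power of [v], because [bar] exchanges the roles of
    the two ends of the stable word. *)
Lemma pinch e h e' a f b b' a' :
  stable_letter_word e = a * f * b -> stable_letter_word e' = b' * bar f * a' ->
  small D a -> small D b -> small D b' -> small D a' -> ~~ small D f ->
  value (b * wd h * b') 1 -> exists k, T e * B h * T e' = B k.
Proof.
have st' := stable_bar st.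
have conjX (x y : K) (e0 : bool) : T e0 * B x * (T e0)^-1 = B y ->
    forall i, T e0 * B (x ^+ i) * (T e0)^-1 = B (y ^+ i) /\
              T e0 * B ((x ^+ i)^-1) * (T e0)^-1 = B ((y ^+ i)^-1).
  move=> xy i; have ei : T e0 * B (x ^+ i) * (T e0)^-1 = B (y ^+ i).
    elim: i => [|i ih]; first by rewrite !expg0 base1 mulg1 mulgV.
    by rewrite !expgS !baseM -ih -xy !mulgA mulgVK.
  by split=> //; rewrite !baseV -ei !invgM invgK mulgA.
case: e e' => -[] /= e1 e2 sa sb sb' sa' bf hv.
- by case: (stable_no_inverse st e1 e2 sa sb sa' sb' bf).
- have e3 : bar ps = bar b * bar f * bar a by rewrite e1 !barM mulgA.
  have [||i hi] := pinch_power st' (given_byV rv gv) (wd_given h) e3 e2 sb sa sb' sa' bf _ _.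
  + by rewrite barK.
  + move=> hc; have [|n [m [n0 hnm]]] := v_rel (k := h).
      apply: val_inj; rewrite !valK_M.
      by apply: (@mulgI _ (phi v)^-1); rewrite /= mulKg mulgA -hc mulgVK.
    exists n, m; split=> //; rewrite expVgn -!valK_X.
    case: hnm => hnm; [right|left].
      by rewrite hnm mulgV.
    by rewrite -valK_V; congr phi; rewrite -(mulg1_eq hnm) invgK.
  have TV : T false = (T true)^-1 by rewrite stable_powerV.
  have vu : T true * B v * (T true)^-1 = B u.
    by rewrite -base_conj TV !mulgA mulgV mul1g mulgK.
  have [c1 c2] := conjX _ _ _ vu i; rewrite TV.
  case: hi => hi.
    exists ((u ^+ i)^-1); rewrite -c2; congr (_ * B _ * _); apply: val_inj.
    by rewrite valK_V valK_X hi expVgn.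
  exists (u ^+ i); rewrite -c1; congr (_ * B _ * _); apply: val_inj.
  by rewrite valK_X hi expVgn invgK.
- have e3 : ps = bar b * bar f * bar a by rewrite -[ps]barK e1 !barM mulgA.
  have [||i hi] := pinch_power st gu (wd_given h) e3 e2 sb sa sb' sa' bf _ _.
  + by rewrite barK.
  + move=> hc; have [|n [m [n0 hnm]]] := u_rel (k := h).
      by apply: val_inj; rewrite !valK_M.
    exists n, m; split=> //; rewrite -!valK_X.
    by case: hnm => hnm; [left; rewrite hnm|right; rewrite -valK_M hnm valK_1].
  have TV : T true = (T false)^-1 by rewrite -stable_powerV invgK.
  have uv : T false * B u * (T false)^-1 = B v by rewrite -base_conj TV.
  have [c1 c2] := conjX _ _ _ uv i; rewrite TV.
  case: hi => hi.
    exists (v ^+ i); rewrite -c1; congr (_ * B _ * _); apply: val_inj.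
    by rewrite valK_X hi.
  exists ((v ^+ i)^-1); rewrite -c2; congr (_ * B _ * _); apply: val_inj.
  by rewrite valK_V valK_X hi.
- have e3 : bar ps = a * f * b := e1.
  by case: (stable_no_inverse st' e3 e2 sa sb sa' sb' bf).
Qed.

(** Each pinch removes two stable letters without leaving the element. *)
Lemma embedding_kernel n k s : size s <= n -> emb (hnn_form u v k s) = 1 ->
  hnn_form u v k s = 1.
Proof.
elim: n k s => [|n ih] k s sn e1.
  case: s sn e1 => // _ /=; rewrite (hnn_map_base valK_M conj_t) -valK_1.
  by move=> /val_inj ->; exact: base1.
have [s0|s0] := pselect (s = [::]).
  by apply: ih => //; rewrite s0.
have hv : value (spell wd stable_letter_word k s) 1.
  by apply/(given_by_value (embedding_form k s)).
have S_len e : wlen (stable_letter_word e) = ('X^D)%R.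
  by case: e; [exact: stable_len st|exact: stable_len (stable_bar st)].
have [s1 [e [h [e' [h' [s2 [a [f [b [b' [a' [es [ee ee'] [sa sb sb' sa'] [_ bf] vm]]]]]]]]]]]] :=
  spell_pinch D_gt0 wd_small S_len s0 hv.
have [g eg] := pinch ee ee' sa sb sb' sa' bf vm.
have [k1 [s3 [e3 sz]]] := hnn_form_mul u v k s1 (g * h') s2.
have ef : hnn_form u v k s = hnn_form u v k1 s3.
  by rewrite es !hnn_form_cat /= -e3 -hnn_form_basel -eg !mulgA.
rewrite ef; apply: ih; last by rewrite -ef.
move: sn; rewrite es sz size_cat /=; lia.
Qed.

Lemma embedding_exists : embeds_into (HNN u v) E.
Proof.
apply: (embeds_intro (hnn_map_is_multiplicative valK_M conj_t)) => x ex.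
have [k [s es]] := hnn_form_surj x.
by rewrite es; apply: (@embedding_kernel (size s)) => //; rewrite -es.
Qed.

End Embedding.

Lemma centralizer_relation (K : groupType) (x : K) : cyclic_subset (centralizer x) ->
  x <> 1 -> forall k, k * x = x * k ->
  exists n m, 0 < n /\ (k ^+ n = x ^+ m \/ k ^+ n * x ^+ m = 1).
Proof.
move=> [c cx] x1 k kx; apply: (@commensurable _ c) => //; rewrite -cx //.
Qed.

Theorem proposition9p4
  (G : groupType) (Sigma : set G)
  (Sigma_gen : generated Sigma = setT)
  (Sigma_neq1 : forall a : G, Sigma a -> a <> 1)
  (H : groupClosed (E_group Sigma))
  (H_fg : finitely_generated H)
  (u v w : subgroup_type H)
  (pu pv pw : word (letter Sigma))
  (u_pu : given_by (val u) pu)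
  (v_pv : given_by (val v) pv)
  (w_pw : given_by (val w) pw)
  (pu_red : cyclically_G_reduced pu)
  (pv_red : cyclically_G_reduced pv)
  (pw_red : cyclically_G_reduced pw)
  (len_uv : wlen pu = wlen pv)
  (len_vw : wlen pv = wlen pw)
  (w_prim : primitive pw)
  (u_cyc : cyclic_subset (centralizer u))
  (v_cyc : cyclic_subset (centralizer v)) :
  embeds_into (HNN u v) (E_group Sigma).
Proof.
have [D0 hD0] := finitely_generated_small H_fg.
pose D := (maxn D0 (zsize (wlen pw))).+1.
have wD : zsize (wlen pw) < D by rewrite ltnS leq_maxr.
have [ps st] := stable_exists w_prim (etrans len_uv len_vw) len_vw wD pu_red pv_red pw_red.
have [t gt] := given_by_ex (stable_reduced st).
have small_word (k : subgroup_type H) : exists x, small D x /\ given_by (val k) x.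
  have /small_elementP [x [_ sx gx]] : val k \in small_element D.
    by apply: hD0; [rewrite leqW // leq_maxl|exact: valP k].
  by exists x.
have neq1 (x : subgroup_type H) px : given_by (val x) px ->
    cyclically_G_reduced px -> wlen px = wlen pw -> x <> 1.
  move=> gx rx lx x1; have [w1 _ _] := w_prim; apply: w1; apply: wlen_eq0.
  rewrite -lx; suff -> : px = 1 by [].
  apply: value_reduced1 (reduced_of_cyclically rx).
  by apply/(given_by_value gx); rewrite x1.
pose wd k := sval (cid (small_word k)).
have wd_small k : small D (wd k) by rewrite /wd; case: cid => x [].
have wd_given k : given_by (val k) (wd k) by rewrite /wd; case: cid => x [].
apply: (@embedding_exists G Sigma D H u v pu pv pw ps t wd _ st u_pu v_pv gt
  (reduced_of_cyclically pv_red) wd_small wd_given) => //.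
  by apply: centralizer_relation => //; apply: neq1 u_pu pu_red (etrans len_uv len_vw).
by apply: centralizer_relation => //; apply: neq1 v_pv pv_red len_vw.
Qed.
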